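(* Let $\alpha\in(\tfrac23,1)$ and $b\neq0$ be real parameters, and for $n\ge1$ put $a_n=n^{\alpha}$, $b_n=bn^{\alpha}$ if $n$ is odd, and $b_n=0$ if $n$ is even. Let $J$ be the self-adjoint Jacobi operator in $l^2(\mathbb{N})$ with diagonal entries $b_n$ and off-diagonal entries $a_n$. Then the spectrum of $J$ on the positive semiaxis is of pure point type. Moreover, if $\lambda>0$ belongs to the point spectrum $\sigma_p(J)$, then the solution $u_n^-$ of the spectral equation (described in the context) is an eigenvector of $J$.
   Context: The operator $J$ is the closure in $l^2(\mathbb{N})$ of the operator $\mathcal{J}$ defined on sequences with finitely many non-zero components by $(\mathcal{J}u)_1=b_1u_1+a_1u_2$ and $(\mathcal{J}u)_n=a_{n-1}u_{n-1}+b_nu_n+a_nu_{n+1}$ for $n\ge2$; it is self-adjoint by the Carleman condition $\sum_{n\ge1} 1/a_n=+\infty$. For $\lambda>0$ the spectral equation is $a_{n-1}u_{n-1}+b_nu_n+a_nu_{n+1}=\lambda u_n$, $n\ge2$. It has a basis of solutions $u_n^+$ and $u_n^-$ with asymptotics, as $n\to\infty$, $$u_{2n}^{\pm}\sim(-1)^n n^{-\frac{\alpha}{4}}\exp\left(\pm\sqrt{\frac{b\lambda}{2^{\alpha}}}\,\frac{n^{1-\frac{\alpha}{2}}}{1-\frac{\alpha}{2}}\right),$$ $$u_{2n+1}^{\pm}\sim\pm\sqrt{\frac{\lambda}{2^{\alpha}b}}\left(1-\frac{\alpha}{2}\right)(-1)^n n^{-\frac{3\alpha}{4}}\exp\left(\pm\sqrt{\frac{b\lambda}{2^{\alpha}}}\,\frac{n^{1-\frac{\alpha}{2}}}{1-\frac{\alpha}{2}}\right),$$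 and $u^-_n$ is the solution corresponding to the lower signs. Here $x_n\sim y_n$ means $x_n/y_n\to1$ as $n\to\infty$.
   Formalization: b≠0 is replaced by b>0 (for b<0 solutions at λ>0 oscillate, so there are no positive eigenvalues though positive spectrum exists), and the factor (1−α/2) in the odd-index asymptotics of u_n^- is dropped, since with it no such solution exists. *)

(* Defs.v *)
From HB Require Import structures.
From mathcomp Require Import all_boot all_order all_algebra.
From mathcomp Require Import all_classical all_reals all_analysis.
From mathcomp Require Import complex.

Set Implicit Arguments.
Unset Strict Implicit.
Unset Printing Implicit Defensive.

Import Order.TTheory GRing.Theory Num.Theory.
Import numFieldNormedType.Exports.

Local Open Scope classical_set_scope.
Local Open Scope ring_scope.
Local Open Scope complex_scope.

Section JacobiOperators.
Variable R : realType.

(* Complex sequences (u_n), n >= 1, keep their own indices: the slot 0 is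
   unused, and is required to be 0 so that equality of functions is equality
   of sequences. *)
Definition l2 (u : nat -> R[i]) : Prop :=
  u 0%N = 0 /\ cvgn (series (fun n => Normc.normc (u n) ^+ 2)).

Definition l2normsq (u : nat -> R[i]) : R :=
  limn (series (fun n => Normc.normc (u n) ^+ 2)).

(* R[i]^o is R[i] with its norm topology. *)
Definition inner (u v : nat -> R[i]) : R[i] :=
  limn (series (fun n => u n * (v n)^* : R[i]^o)).

Definition finitely_supported (u : nat -> R[i]) : Prop :=
  u 0%N = 0 /\ exists N : nat, forall n, (N <= n)%N -> u n = 0.

Definition jacobi_expr (a d : nat -> R) (u : nat -> R[i]) (n : nat) : R[i] :=
  match n with
  | 0%N => 0
  | 1%N => (d 1%N)%:C * u 1%N + (a 1%N)%:C * u 2%N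
  | _ => (a n.-1)%:C * u n.-1 + (d n)%:C * u n + (a n)%:C * u n.+1
  end.

(* Unbounded operators in l^2 are given by their graphs: T u f means that u is
   in the domain of T and T u = f.  The graph of the Jacobi operator is the
   closure, in l^2 x l^2, of the graph of jacobi_expr on finitely supported
   sequences. *)
Definition jacobi_op (a d : nat -> R) (u f : nat -> R[i]) : Prop :=
  [/\ l2 u, l2 f &
    exists v : nat -> (nat -> R[i]),
      [/\ forall k, finitely_supported (v k),
          l2normsq (v k \- u) @[k --> \oo] --> (0 : R) &
          l2normsq (jacobi_expr a d (v k) \- f) @[k --> \oo] --> (0 : R)]].

Definition eigenvector (T : (nat -> R[i]) -> (nat -> R[i]) -> Prop)
    (z : R[i]) (u : nat -> R[i]) : Prop :=
  (exists n, u n != 0) /\ T u (fun n => z * u n).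

Definition point_spectrum (T : (nat -> R[i]) -> (nat -> R[i]) -> Prop) :
  set R[i] := [set z | exists u, eigenvector T z u].

(* A projection-valued Borel measure on R acting in l^2.  Since every proj B is
   an orthogonal projection, `|proj B u|^2 = <proj B u, u>; smeas u is the
   corresponding scalar measure, whose existence expresses countable
   additivity.  The values of proj and smeas outside l^2 are irrelevant. *)
Record pvm := Pvm {
  proj : set (measurableTypeR R) -> (nat -> R[i]) -> (nat -> R[i]) ;
  smeas : (nat -> R[i]) -> {measure set (measurableTypeR R) -> \bar R} ;
  proj_l2 : forall B u, measurable B -> l2 u -> l2 (proj B u) ;
  proj_linear : forall B z u v, measurable B -> l2 u -> l2 v ->
    proj B (fun n => z * u n + v n) = (fun n => z * proj B u n + proj B v n) ;
  proj_sym : forall B u v, measurable B -> l2 u -> l2 v ->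
    inner (proj B u) v = inner u (proj B v) ;
  proj_setT : forall u, l2 u -> proj setT u = u ;
  proj_setI : forall A B u, measurable A -> measurable B -> l2 u ->
    proj (A `&` B) u = proj A (proj B u) ;
  smeasE : forall B u, measurable B -> l2 u ->
    smeas u B = (l2normsq (proj B u))%:E }.

(* E is the spectral measure of T, i.e. T is the integral of x against E.  The
   domains agree by the first clause; by polarization the diagonal matrix
   elements in the second one determine T on its domain. *)
Definition spectral_measure_of (T : (nat -> R[i]) -> (nat -> R[i]) -> Prop)
    (E : pvm) : Prop :=
  (forall u, l2 u ->
     (exists f, T u f) <-> (\int[smeas E u]_x (x ^+ 2)%:E < +oo)%E) /\
  (forall u f, T u f -> inner f u = (\int[smeas E u]_x x)%:C).

(* On S every scalar spectral measure is the sum of its atoms. *)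
Definition pure_point_on (E : pvm) (S : set (measurableTypeR R)) : Prop :=
  forall u, l2 u -> forall B, measurable B -> B `<=` S ->
    smeas E u B = \esum_(x in B) smeas E u [set x].

(* T is a self-adjoint operator, so that its spectral measure exists and is
   unique. *)
Definition pure_point_spectrum_on
    (T : (nat -> R[i]) -> (nat -> R[i]) -> Prop)
    (S : set (measurableTypeR R)) : Prop :=
  forall E : pvm, spectral_measure_of T E -> pure_point_on E S.

Definition offdiag_entry (alpha : R) (n : nat) : R := n%:R `^ alpha.

Definition diag_entry (alpha b : R) (n : nat) : R :=
  if odd n then b * n%:R `^ alpha else 0.

Definition spectral_solution (a d : nat -> R) (lambda : R)
    (u : nat -> R[i]) : Prop :=
  u 0%N = 0 /\
  forall n, (2 <= n)%N ->
    (a n.-1)%:C * u n.-1 + (d n)%:C * u n + (a n)%:C * u n.+1 =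
    lambda%:C * u n.

Definition decay (alpha b lambda : R) (n : nat) : R :=
  expR (- (Num.sqrt (b * lambda / 2 `^ alpha) *
           (n%:R `^ (1 - alpha / 2) / (1 - alpha / 2)))).

Definition uminus_even (alpha b lambda : R) (n : nat) : R :=
  (-1) ^+ n * n%:R `^ (- (alpha / 4)) * decay alpha b lambda n.

(* The constant is forced by uminus_even.  Write u_{2n} = (-1)^n x_n and
   u_{2n+1} = (-1)^n y_n; the spectral equation at the index 2n+1 reads
     (2n)^alpha x_n + (b (2n+1)^alpha - lambda) y_n = (2n+1)^alpha x_{n+1},
   hence b y_n ~ x_{n+1} - x_n ~ - sqrt (b lambda / 2^alpha) n^(-alpha/2) x_n;
   an additional factor 1 - alpha/2 would leave no solution at all. *)
Definition uminus_odd (alpha b lambda : R) (n : nat) : R :=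
  - Num.sqrt (lambda / (2 `^ alpha * b)) *
  (-1) ^+ n * n%:R `^ (- (3 * alpha / 4)) * decay alpha b lambda n.

Definition is_uminus (alpha b lambda : R) (u : nat -> R[i]) : Prop :=
  [/\ spectral_solution (offdiag_entry alpha) (diag_entry alpha b) lambda u,
      (u n.*2 / (uminus_even alpha b lambda n)%:C : R[i]^o)
        @[n --> \oo] --> (1 : R[i]^o) &
      (u n.*2.+1 / (uminus_odd alpha b lambda n)%:C : R[i]^o)
        @[n --> \oo] --> (1 : R[i]^o)].

End JacobiOperators.

(* Main.v *)
Require Import Defs.
From HB Require Import structures.
From mathcomp Require Import all_boot all_order all_algebra.
From mathcomp Require Import all_classical all_reals all_analysis.
From mathcomp Require Import complex.
From mathcomp Require finmap.
From mathcomp Require Import measurable_realfun.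
From mathcomp Require Import ring lra zify.

Set Implicit Arguments.
Unset Strict Implicit.
Unset Printing Implicit Defensive.

Import Order.TTheory GRing.Theory Num.Theory.
Import numFieldNormedType.Exports.

Local Open Scope classical_set_scope.
Local Open Scope ring_scope.
Local Open Scope complex_scope.

(** Let P n lambda be the solution of the full three-term recurrence with
    P 0 = 0 and P 1 = 1 (opoly), let E be a spectral measure of J, and let mu n
    be the scalar measure of the n-th unit vector e n.

    The generalized eigenfunctions grow slowly.  If B lies within delta of
    lambda, then E(B) almost intertwines J with multiplication by lambda, with
    an error of relative size delta (proj_jacobi_le).  Running the recurrence on
    E(B) e_n shows that E(B) e_n is close to P n lambda times E(B) e_1
    (basis_approx).  Cutting a bounded interval into short pieces bounds the
    integral of (P n)^2 against mu 1 uniformly in n (opoly_sq_integral_le).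
    Consequently, for mu 1-almost every lambda, the values P n lambda do not grow
    linearly, not even along a sparse sequence of indices (opoly_ae_series).

    Solutions with slow growth decay.  For lambda > 0 put
    x_m = (-1)^m u_(2m) and y_m = (-1)^m u_(2m+1).  For large m the
    spectral equation is then a first order system with positive coefficients.
    A real solution which reaches the cone x, y >= 0 (or its opposite) stays in
    it and grows at least linearly; otherwise x_m and y_m always have opposite
    signs, |x_m| and |y_m| decrease, and a comparison of sums gives a bound in
    1/m (growth_or_decay).

    The decaying solutions are exceptional.  They are square summable, and by
    Green's formula those for different lambda are orthogonal.  As they all have
    first component 1, Bessel's inequality for e 1 leaves only countably many of
    them (countable_decaying).  So mu 1 restricted to the positive axis is
    carried by a countable set; as e 1 is cyclic, so is every scalar spectral
    measure (smeas_null_of_basis1), and a measure carried by a countable set is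
    the sum of its atoms (pure_point_criterion).

    As for eigenvectors, if v is one for lambda > 0 and u is the solution
    u^-, the constant a_n (u_n v_(n+1) - u_(n+1) v_n) is 0, because a_n u_n
    tends to 0 and v is bounded.  Hence u is a multiple of v. *)

(** * Growth or decay of solutions *)

(** The system below is the spectral equation at the indices 2m+1 and 2m+2, for
    x_m = (-1)^m u_(2m) and y_m = (-1)^m u_(2m+1).  From the index N on, the
    coefficient b c_(2m+1) - lambda is positive, and even at least half of
    b c_(2m+1). *)
Section Cone.
Variables (R : realType) (c : nat -> R) (b lambda : R) (x y : nat -> R) (N : nat).
Hypotheses (b_gt0 : 0 < b) (lambda_gt0 : 0 < lambda).
Hypotheses (c_gt0 : forall k, (0 < k)%N -> 0 < c k)
  (c_nd : forall k, c k <= c k.+1) (c_le : forall k, c k <= k%:R).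
Hypothesis N_gt0 : (0 < N)%N.
Hypothesis N_large : forall m, (N <= m)%N -> 2 * lambda <= b * c m.*2.+1.
Hypothesis recy : forall m,
  c m.*2.+2 * y m.+1 = c m.*2.+1 * y m + lambda * x m.+1.
Hypothesis recx : forall m,
  c m.*2.+1 * x m.+1 = c m.*2 * x m + (b * c m.*2.+1 - lambda) * y m.

Lemma cone_invariant m : (N <= m)%N -> 0 <= x m -> 0 <= y m -> 0 < x m + y m ->
  0 < x m.+1 /\ 0 < y m.+1.
Proof.
have b0 := b_gt0; have l0 := lambda_gt0.
move=> Nm x0 y0 xy0.
have c0 : 0 < c m.*2 by apply: c_gt0; lia.
have c1 : 0 < c m.*2.+1 by apply: c_gt0.
have c2 : 0 < c m.*2.+2 by apply: c_gt0.
have Nl := N_large Nm.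
have px : 0 < x m.+1.
  rewrite -(pmulr_rgt0 _ c1) recx.
  have bl : 0 < b * c m.*2.+1 - lambda by lra.
  move: y0 xy0; rewrite le_eqVlt => /orP[/eqP <-|y0 _].
    by rewrite addr0 mulr0 addr0 => ?; rewrite mulr_gt0.
  by rewrite ltr_wpDl// ?mulr_ge0 ?mulr_gt0// ltW.
split => //.
rewrite -(pmulr_rgt0 _ c2) recy.
by rewrite ltr_wpDl// ?mulr_ge0 ?mulr_gt0// ltW.
Qed.

(** X_m = c_(2m) x_m and Y_m = c_(2m) y_m satisfy
    X_(m+1) - X_m >= (b/2) Y_m and Y_(m+1) - Y_m >= (lambda/2) X_(m+1) / (m+1).
    The pair (m^2, (6/b) m) is a subsolution of this system for large m, so that X_m grows
    at least quadratically, and x_m >= X_m / (2m) at least linearly. *)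
Lemma cone_growth : 0 <= x N -> 0 <= y N -> 0 < x N + y N ->
  exists e M, 0 < e /\ forall m, (M <= m)%N -> e * m%:R <= x m.
Proof.
have b0 := b_gt0; have l0 := lambda_gt0.
move=> x0 y0 xy0.
have pos m : (N < m)%N -> 0 < x m /\ 0 < y m.
  elim: m => // m IH; rewrite ltnS leq_eqVlt => /orP[/eqP <-|Nm].
    exact: cone_invariant.
  have [xm ym] := IH Nm.
  by apply: cone_invariant; [exact: ltnW|exact: ltW|exact: ltW|lra].
pose X m := c m.*2 * x m; pose Y m := c m.*2 * y m.
have stepX m : (N < m)%N -> X m + b / 2 * Y m <= X m.+1.
  move=> Nm; have [xm ym] := pos _ Nm; have [xm1 ym1] := pos m.+1 (ltnW Nm).
  rewrite /X /Y doubleS.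
  have h1 : c m.*2.+1 * x m.+1 <= c m.*2.+2 * x m.+1 by rewrite ler_pM2r.
  apply: le_trans h1; rewrite recx.
  have h2 : c m.*2 * y m <= c m.*2.+1 * y m by rewrite ler_pM2r.
  have h3 : 2 * lambda * y m <= b * c m.*2.+1 * y m.
    by rewrite ler_pM2r// N_large// ltnW.
  have h4 : b * (c m.*2 * y m) <= b * (c m.*2.+1 * y m) by rewrite ler_pM2l.
  lra.
have stepY m : (N < m)%N -> Y m + lambda / 2 * (X m.+1 / m.+1%:R) <= Y m.+1.
  move=> Nm; have [xm ym] := pos _ Nm; have [xm1 ym1] := pos m.+1 (ltnW Nm).
  rewrite /X /Y doubleS recy.
  have h2 : c m.*2 * y m <= c m.*2.+1 * y m by rewrite ler_pM2r.
  suff h : c m.*2.+2 * x m.+1 / m.+1%:R <= 2 * x m.+1.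
    move: h; set q := _ / _ => h.
    have : lambda * q <= lambda * (2 * x m.+1) by rewrite ler_pM2l.
    lra.
  rewrite ler_pdivrMr// -mulrA (mulrC (x _)) mulrA ler_pM2r//.
  have := c_le m.*2.+2.
  by rewrite -doubleS -muln2 natrM mulrC.
have XP m : (N < m)%N -> 0 < X m.
  by move=> Nm; rewrite mulr_gt0 ?(pos _ Nm).1// c_gt0//; lia.
have YP m : (N < m)%N -> 0 < Y m.
  by move=> Nm; rewrite mulr_gt0 ?(pos _ Nm).2// c_gt0//; lia.
(* the linear bound e K m for Y feeds the increment 2m + 1 <= 3m of m^2 *)
pose K := 6 / b.
have K0 : 0 < K by rewrite divr_gt0.
(* the quadratic lower bound for X propagates beyond this index *)
pose M0 := Num.trunc (2 * K / lambda).
pose M := (maxn N.+1 M0.+1).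
have NM : (N < M)%N by rewrite leq_max leqnn.
have M0M : (M0 < M)%N by rewrite leq_max leqnn orbT.
have Mgt0 : 0 < M%:R :> R by rewrite ltr0n; exact: leq_ltn_trans NM.
pose e := Num.min (X M / M%:R ^+ 2) (Y M / (K * M%:R)).
have e0 : 0 < e.
  by rewrite lt_min !divr_gt0 ?XP ?YP ?exprn_gt0// mulr_gt0.
have claim m : (M <= m)%N -> e * m%:R ^+ 2 <= X m /\ e * K * m%:R <= Y m.
  elim: m => [|m IH]; first by rewrite leqn0 => /eqP M00; move: Mgt0; rewrite M00 ltxx.
  rewrite leq_eqVlt => /orP[/eqP <-|].
    split.
      by rewrite -ler_pdivlMr ?exprn_gt0// /e ge_min lexx.
    have KM : 0 < K * M%:R by exact: mulr_gt0.
    by rewrite -mulrA -ler_pdivlMr// /e ge_min lexx orbT.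
  rewrite ltnS => Mm; have [hX hY] := IH Mm.
  have Nm : (N < m)%N by apply: leq_trans Mm.
  have sX := stepX _ Nm; have sY := stepY _ Nm.
  have m1 : 1 <= m%:R :> R by rewrite ler1n; exact: leq_ltn_trans Nm.
  have hX1 : e * m.+1%:R ^+ 2 <= X m.+1.
    apply: le_trans sX.
    have h : b / 2 * (e * K * m%:R) <= b / 2 * Y m by rewrite ler_pM2l// divr_gt0.
    have -> : e * m.+1%:R ^+ 2 = e * m%:R ^+ 2 + e * (2 * m%:R + 1).
      by rewrite -natr1; ring.
    have e1 : b / 2 * (e * K * m%:R) = e * (3 * m%:R).
      by rewrite /K; field; rewrite gt_eqF.
    have : e * (2 * m%:R + 1) <= e * (3 * m%:R) by rewrite ler_pM2l//; lra.
    lra.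
  split => //.
  apply: le_trans sY.
  have h : e * m.+1%:R <= X m.+1 / m.+1%:R.
    by rewrite ler_pdivlMr// -mulrA -expr2.
  have hK : K <= lambda / 2 * m.+1%:R.
    have h1 : 2 * K / lambda <= m.+1%:R.
      apply: ltW; apply: lt_le_trans (truncnS_gt _) _.
      by rewrite ler_nat; apply: leq_trans M0M _; apply: leq_trans Mm _.
    by move: h1; rewrite ler_pdivrMr//; lra.
  have h5 : e * K <= lambda / 2 * (X m.+1 / m.+1%:R).
    apply: (@le_trans _ _ (e * (lambda / 2 * m.+1%:R))); first by rewrite ler_pM2l.
    have -> : e * (lambda / 2 * m.+1%:R) = lambda / 2 * (e * m.+1%:R) by ring.
    by rewrite ler_pM2l// divr_gt0.
  have -> : e * K * m.+1%:R = e * K * m%:R + e * K by rewrite -natr1; ring.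
  exact: lerD.
exists (e / 2), M; split=> [|m Mm]; first by rewrite divr_gt0.
have [hX _] := claim _ Mm.
have Nm : (N < m)%N by apply: leq_trans Mm.
have m0 : 0 < m%:R :> R by rewrite ltr0n; exact: leq_ltn_trans Nm.
have [xm _] := pos _ Nm.
have h : X m <= 2 * m%:R * x m.
  rewrite /X ler_pM2r//; apply: le_trans (c_le _) _.
  by rewrite -muln2 natrM mulrC.
rewrite -(ler_pM2l m0); move: hX h; rewrite expr2; lra.
Qed.

(** The signs of x and y persist: if x became nonpositive, the next y would still
    be negative and their product nonnegative.  With z = - y > 0 one gets
    x_(m+1) <= x_m - (b/2) z_m and lambda x_(m+1) <= (2m+2) (z_m - z_(m+1)).
    The first bound sums to a finite total for the decreasing z, whence
    z_m = O(1/m).  Summing the second one between M and 2M, where x is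
    decreasing, gives M lambda x_(2M) <= 4M z_M, which is bounded; hence
    x_m = O(1/m). *)
Lemma cone_decay : 0 < x N -> (forall m, (N <= m)%N -> x m * y m < 0) ->
  exists C M, forall m, (M <= m)%N -> m%:R * `|x m| <= C /\ m%:R * `|y m| <= C.
Proof.
have b0 := b_gt0; have l0 := lambda_gt0.
move=> xN xy.
have pos m : (N <= m)%N -> 0 < x m /\ y m < 0.
  elim: m => [|m IH]; first by move=> h; have := leq_trans N_gt0 h.
  rewrite leq_eqVlt => /orP[/eqP e|].
    split; rewrite -e//.
    by have := xy N (leqnn N); rewrite pmulr_rlt0.
  rewrite ltnS => Nm; have [xm ym] := IH Nm.
  have c1 : 0 < c m.*2.+1 by apply: c_gt0.
  have c2 : 0 < c m.*2.+2 by apply: c_gt0.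
  have h := xy m.+1 (leqW Nm).
  suff px : 0 < x m.+1 by split => //; move: h; rewrite pmulr_rlt0.
  rewrite ltNge; apply/negP => x1.
  have y1 : y m.+1 < 0.
    rewrite -(pmulr_rlt0 _ c2) recy.
    have : c m.*2.+1 * y m < 0 by rewrite pmulr_rlt0.
    have : lambda * x m.+1 <= 0 by rewrite pmulr_rle0.
    lra.
  by move: h; rewrite ltNge mulr_le0// ltW.
pose z m := - y m.
have z0 m : (N <= m)%N -> 0 < z m by move=> /pos[_]; rewrite oppr_gt0.
have x0 m : (N <= m)%N -> 0 < x m by move=> /pos[].
have stepx m : (N <= m)%N -> x m.+1 <= x m - b / 2 * z m.
  move=> Nm; have c1 : 0 < c m.*2.+1 by apply: c_gt0.
  rewrite -(ler_pM2l c1) recx.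
  have h1 : c m.*2 * x m <= c m.*2.+1 * x m by rewrite ler_pM2r ?x0.
  have h3 : 2 * lambda * z m <= b * c m.*2.+1 * z m.
    by rewrite ler_pM2r ?z0// N_large.
  have -> : y m = - z m by rewrite opprK.
  lra.
have stepz m : (N <= m)%N -> lambda * x m.+1 <= 2 * m.+1%:R * (z m - z m.+1).
  move=> Nm.
  have c2 : 0 < c m.*2.+2 by apply: c_gt0.
  have h : lambda * x m.+1 <= c m.*2.+2 * (z m - z m.+1).
    have : c m.*2.+1 * z m <= c m.*2.+2 * z m by rewrite ler_pM2r ?z0.
    have := recy m.
    have -> : y m = - z m by rewrite opprK.
    have -> : y m.+1 = - z m.+1 by rewrite opprK.
    lra.
  have hz : 0 <= z m - z m.+1.
    rewrite -(pmulr_rge0 _ c2); apply: le_trans h.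
    by rewrite mulr_ge0 ?ltW// x0// leqW.
  apply: le_trans h _; rewrite ler_wpM2r//.
  by apply: le_trans (c_le _) _; rewrite -doubleS -muln2 natrM mulrC.
have zdec m : (N <= m)%N -> z m.+1 <= z m.
  move=> Nm; rewrite -subr_ge0.
  have m0 : 0 < 2 * m.+1%:R :> R by rewrite mulr_gt0.
  rewrite -(pmulr_rge0 _ m0); apply: le_trans (stepz _ Nm).
  by rewrite mulr_ge0 ?ltW// x0// leqW.
have xdec m : (N <= m)%N -> x m.+1 <= x m.
  move=> Nm; apply: le_trans (stepx _ Nm) _.
  by rewrite gerBl mulr_ge0 ?ltW ?z0// divr_gt0.
have sumz k : b / 2 * k%:R * z (N + k)%N + x (N + k)%N <= x N.
  elim: k => [|k]; first by rewrite addn0 mulr0 mul0r add0r.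
  apply: le_trans; rewrite addnS -[k.+1%:R]natr1.
  have Nk : (N <= N + k)%N by rewrite leq_addr.
  have hx := stepx _ Nk.
  have b2 : 0 <= b / 2 * (k%:R + 1) by rewrite mulr_ge0 ?addr_ge0// ltW// divr_gt0.
  have := ler_wpM2l b2 (zdec _ Nk).
  lra.
pose C := 4 * x N / b.
have C0 : 0 <= C by rewrite !mulr_ge0// ?invr_ge0 ltW.
have zC m : (N.*2 <= m)%N -> m%:R * z m <= C.
  move=> Nm.
  have Nm' : (N <= m)%N by lia.
  have := sumz (m - N)%N; rewrite subnKC// => h.
  have xm := x0 _ Nm'; have zm := z0 _ Nm'.
  have h2 : m%:R <= 2 * (m - N)%:R :> R.
    by rewrite -natrM ler_nat; lia.
  have h3 : b / 4 * m%:R * z m <= b / 2 * (m - N)%:R * z m.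
    rewrite ler_pM2r//; move: h2; set q := (m - N)%:R => h2.
    have : b * m%:R <= b * (2 * q) by rewrite ler_pM2l.
    lra.
  rewrite /C ler_pdivlMr//; lra.
have tel M k : (N <= M)%N -> (k <= M)%N ->
    lambda * k%:R * x (M + k)%N <= 4 * M%:R * (z M - z (M + k)%N).
  move=> NM; elim: k => [|k IH] kM.
    by rewrite addn0 subrr !mulr0 mul0r.
  have {IH} := IH (ltnW kM); rewrite addnS -[k.+1%:R]natr1 => IH.
  have Nk : (N <= M + k)%N by apply: leq_trans NM (leq_addr _ _).
  have h1 := stepz _ Nk.
  have h2 : 2 * (M + k).+1%:R * (z (M + k)%N - z (M + k).+1) <=
            4 * M%:R * (z (M + k)%N - z (M + k).+1).
    rewrite ler_wpM2r ?subr_ge0 ?zdec// -!natrM ler_nat; lia.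
  have h3 : lambda * k%:R * x (M + k).+1 <= lambda * k%:R * x (M + k)%N.
    by rewrite ler_wpM2l ?xdec// mulr_ge0// ltW.
  lra.
(* D / 3 bounds M x_(2M); the factor 3 pays for m <= 3 M when m is 2M or 2M+1 *)
pose D := 12 * C / lambda.
have D0 : 0 <= D by apply: divr_ge0; [exact: mulr_ge0|exact: ltW].
have xD M : (N.*2 <= M)%N -> M%:R * x M.*2 <= D / 3.
  move=> NM.
  have NM' : (N <= M)%N by lia.
  have := tel M M NM' (leqnn _); rewrite addnn => h.
  have zM := zC _ NM.
  have : 0 < z M.*2 by apply: z0; lia.
  move=> zp.
  have h2 : M%:R * (z M - z M.*2) <= C.
    apply: le_trans zM; rewrite ler_wpM2l//; lra.
  rewrite -(ler_pM2l lambda_gt0).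
  have -> : lambda * (D / 3) = 4 * C by rewrite /D; field; rewrite gt_eqF.
  lra.
exists (Num.max C D), (N * 4)%N => m Nm.
have Nm' : (N <= m)%N by lia.
have zm := z0 _ Nm'; have xm := x0 _ Nm'.
split; last first.
  rewrite le_max -normrN gtr0_norm// zC//; lia.
rewrite le_max gtr0_norm//; apply/orP; right.
have NM : (N.*2 <= m./2)%N by lia.
have hM := xD _ NM.
have m3 : m%:R <= 3 * m./2%:R :> R by rewrite -natrM ler_nat; lia.
apply: (@le_trans _ _ (3 * m./2%:R * x m)); first by rewrite ler_pM2r.
have : x m <= x m./2.*2.
  rewrite -{1}(odd_double_half m); case: (odd m); rewrite ?add0n// add1n.
  by apply: xdec; lia.
move=> /(ler_wpM2l (ler0n R m./2)); lra.
Qed.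

End Cone.

Section Dichotomy.
Variables (R : realType) (c d : nat -> R) (b lambda : R) (p : nat -> R).
Hypotheses (b_gt0 : 0 < b) (lambda_gt0 : 0 < lambda).
Hypotheses (c_gt0 : forall k, (0 < k)%N -> 0 < c k)
  (c_nd : forall k, c k <= c k.+1) (c_le : forall k, c k <= k%:R)
  (c_unbounded : forall A, exists k, A <= c k).
Hypothesis dE : forall k, d k = if odd k then b * c k else 0.
Hypothesis recp : forall n,
  c n * p n + d n.+1 * p n.+1 + c n.+1 * p n.+2 = lambda * p n.+1.
Hypothesis p_neq0 : p 1%N != 0.

(** A nontrivial real solution either reaches, up to sign, the cone x, y >= 0 of
    cone_growth, or eventually has x_m y_m < 0 as in cone_decay.  The factor s
    normalizes the sign. *)
Lemma growth_or_decay :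
  (exists e M, 0 < e /\ forall m, (M <= m)%N -> e * m%:R <= `|p m.*2|) \/
  (exists C M, forall k, (M <= k)%N -> k%:R * `|p k| <= C).
Proof.
have b0 := b_gt0; have l0 := lambda_gt0.
pose x (s : R) m : R := s * (-1) ^+ m * p m.*2; pose y (s : R) m : R := s * (-1) ^+ m * p m.*2.+1.
have recy s m : c m.*2.+2 * y s m.+1 = c m.*2.+1 * y s m + lambda * x s m.+1.
  have := recp m.*2.+1; rewrite dE /= odd_double /= /x /y doubleS exprS => h.
  apply/eqP; rewrite -subr_eq0; apply/eqP.
  transitivity (s * (-1) ^+ m * (lambda * p m.*2.+2 - (c m.*2.+1 * p m.*2.+1 +
    0 * p m.*2.+2 + c m.*2.+2 * p m.*2.+3))); first by ring.
  by rewrite h subrr mulr0.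
have recx s m : c m.*2.+1 * x s m.+1 =
    c m.*2 * x s m + (b * c m.*2.+1 - lambda) * y s m.
  have := recp m.*2; rewrite dE /= odd_double /= /x /y doubleS exprS => h.
  apply/eqP; rewrite -subr_eq0; apply/eqP.
  transitivity (s * (-1) ^+ m * (lambda * p m.*2.+1 - (c m.*2 * p m.*2 +
    b * c m.*2.+1 * p m.*2.+1 + c m.*2.+1 * p m.*2.+2))); first by ring.
  by rewrite h subrr mulr0.
have [N1 N1P] := c_unbounded (2 * lambda / b).
have c_mono i j : (i <= j)%N -> c i <= c j.
  by move=> ij; have /nondecreasing_seqP := c_nd; exact.
pose N := N1.+1.
have N_large m : (N <= m)%N -> 2 * lambda <= b * c m.*2.+1.
  move=> Nm; rewrite mulrC (mulrC b) -ler_pdivrMr// (mulrC lambda).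
  by apply: le_trans N1P _; apply: c_mono; lia.
have xabs (s : R) m : `|s| = 1 -> `|x s m| = `|p m.*2|.
  by move=> s1; rewrite /x !normrM s1 normrX normrN1 expr1n !mul1r.
have yabs (s : R) m : `|s| = 1 -> `|y s m| = `|p m.*2.+1|.
  by move=> s1; rewrite /y !normrM s1 normrX normrN1 expr1n !mul1r.
have nz k : p k != 0 \/ p k.+1 != 0.
  elim: k => [|k IH]; first by right.
  case: (eqVneq (p k.+1) 0) => [e|]; [right|by left].
  case: IH => h; last by rewrite e eqxx in h.
  have := recp k; rewrite e !mulr0 addr0 => /eqP.
  rewrite addr_eq0 => /eqP h2.
  apply: contra_neq h => p0; apply/eqP.
  move: h2; rewrite p0 mulr0 oppr0 => /eqP; rewrite mulf_eq0.
  case: k e p0 => [|k] e p0; first by case/eqP: p_neq0.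
  by rewrite gt_eqF ?c_gt0.
have [[m [Nm hm]]|/forallNP opp] := pselect (exists m, (N <= m)%N /\ 0 <= x 1 m * y 1 m).
  left.
  have [s [s1 sx sy]] : exists s, [/\ `|s| = 1, 0 <= x s m & 0 <= y s m].
    have sc (s : R) k : x s k = s * x 1 k /\ y s k = s * y 1 k.
      by rewrite /x /y !mul1r !mulrA.
    have := lexx (x 1 m); move: hm.
    case: (ltrgtP (x 1 m) 0) => [x0|x0|x0] hm _.
    - exists (-1); rewrite normrN1 (sc (-1) m).1 (sc (-1) m).2; split=> //; first lra.
      by move: hm; rewrite nmulr_rge0//; lra.
    - exists 1; rewrite normr1; split=> //; first exact: ltW.
      by move: hm; rewrite pmulr_rge0.
    case: (leP 0 (y 1 m)) => y0; first by exists 1; rewrite normr1 x0.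
    exists (-1); rewrite normrN1 (sc (-1) m).1 (sc (-1) m).2 x0; split=> //; lra.
  have mlarge k : (m <= k)%N -> 2 * lambda <= b * c k.*2.+1.
    by move=> mk; apply: N_large; apply: leq_trans Nm mk.
  have m0 : (0 < m)%N by apply: leq_trans Nm.
  have xyp : 0 < x s m + y s m.
    rewrite lt_neqAle addr_ge0// andbT eq_sym paddr_eq0//.
    have := nz m.*2; rewrite -(normr_eq0 (p m.*2)) -(normr_eq0 (p m.*2.+1)).
    rewrite -(xabs s)// -(yabs s)// !normr_eq0.
    by case=> /negbTE ->; rewrite ?andbF.
  have [e [M [e0 h]]] := cone_growth b_gt0 lambda_gt0 c_gt0 c_nd c_le m0 mlarge
    (recy s) (recx s) sx sy xyp.
  exists e, M; split => // k Mk; rewrite -(xabs s)//.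
  exact: le_trans (h _ Mk) (ler_norm _).
right.
have neg m : (N <= m)%N -> x 1 m * y 1 m < 0.
  move=> Nm; have := opp m => /not_andP[//|/negP].
  by rewrite -ltNge.
have [s [s1 sx]] : exists s, `|s| = 1 /\ 0 < x s N.
  have := neg _ (leqnn N); case: (ltrgtP (x 1 N) 0) => [h _|h _|->].
  - exists (-1); rewrite normrN1; split=> //.
    by have -> : x (-1) N = - x 1 N; [rewrite /x; ring|lra].
  - by exists 1; rewrite normr1.
  by rewrite mul0r ltxx.
have sneg m : (N <= m)%N -> x s m * y s m < 0.
  move=> /neg; suff -> : x s m * y s m = x 1 m * y 1 m by [].
  have s2 : s ^+ 2 = 1 by rewrite -(real_normK (num_real s)) s1 expr1n.
  transitivity (s ^+ 2 * (x 1 m * y 1 m)); first by rewrite /x /y; ring.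
  by rewrite s2 mul1r.
have [C [M h]] := cone_decay b_gt0 lambda_gt0 c_gt0 c_nd c_le (ltn0Sn N1) N_large
    (recy s) (recx s) sx sneg.
exists (3 * C), M.*2.+2 => k Mk.
have Mk' : (M <= k./2)%N by lia.
have [hx hy] := h _ Mk'.
have k3 : k%:R <= 3 * k./2%:R :> R by rewrite -natrM ler_nat; lia.
have hp : k./2%:R * `|p k| <= C.
  rewrite -(odd_double_half k) half_bit_double.
  by case: (odd k); rewrite ?add1n ?add0n; [rewrite -(yabs s)|rewrite -(xabs s)].
apply: le_trans (ler_wpM2r (normr_ge0 _) k3) _; lra.
Qed.

End Dichotomy.

(** * Square summable sequences and the graph of the Jacobi operator *)

Section RealInnerProduct.
Variable R : realType.
Implicit Types (u v w f : nat -> R[i]) (z : R[i]).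

Definition rdot z z' : R := complex.Re z * complex.Re z' + complex.Im z * complex.Im z'.

(** The real part of the inner product: l2 is treated as a real Hilbert space,
    which suffices for polarization. *)
Definition rin u v : R := limn (series (fun n => rdot (u n) (v n))).

(** The shape of the linearity axiom for the projections; every linear operation
    on sequences below goes through it. *)
Definition lin z u v : nat -> R[i] := fun n => z * u n + v n.

(** The unit vectors; the index 0 gives the zero sequence, so that the recurrence
    for J (ebasis n) has the same form at n = 1 as elsewhere. *)
Definition ebasis (n k : nat) : R[i] := if (0 < n)%N && (k == n) then 1 else 0.

Lemma normc_sq z : Normc.normc z ^+ 2 = rdot z z.
Proof. by case: z => x y; rewrite /= sqr_sqrtr ?addr_ge0 ?sqr_ge0. Qed.

Lemma rdotC z z' : rdot z z' = rdot z' z.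
Proof. by rewrite /rdot ![_ * complex.Re z]mulrC ![_ * complex.Im z]mulrC. Qed.

Lemma rdot_lin (c : R) z z' (w : R[i]) : rdot (c%:C * z + z') w = c * rdot z w + rdot z' w.
Proof. by case: z z' w => [x y] [x' y'] [p q]; rewrite /rdot /=; ring. Qed.

Lemma rdot_ge0 z : 0 <= rdot z z.
Proof. by rewrite -normc_sq sqr_ge0. Qed.

Lemma rdot_bound z (w : R[i]) : `|rdot z w| <= rdot z z + rdot w w.
Proof.
case: z w => [x y] [p q]; rewrite /rdot /= ler_norml; apply/andP.
have h1 := sqr_ge0 (x + p); have h2 := sqr_ge0 (y + q).
have h3 := sqr_ge0 (x - p); have h4 := sqr_ge0 (y - q).
have h5 := sqr_ge0 x; have h6 := sqr_ge0 y; have h7 := sqr_ge0 p; have h8 := sqr_ge0 q.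
by split; lra.
Qed.

Lemma series_eventually0 (V : normedModType R) (f : nat -> V) N :
  (forall k, (N <= k)%N -> f k = 0) -> series f @ \oo --> series f N.
Proof.
move=> f0; apply: cvg_near_cst; exists N => //= n /= Nn.
rewrite !seriesEnat/= (big_cat_nat (n := N))//= [X in _ + X]big_nat.
by rewrite [X in _ + X]big1 ?addr0// => i /andP[Ni _]; exact: f0.
Qed.

Lemma l2P u : l2 u <-> u 0%N = 0 /\ cvgn (series (fun n => rdot (u n) (u n))).
Proof.
rewrite /l2; have -> // : (fun n => Normc.normc (u n) ^+ 2) = fun n => rdot (u n) (u n).
by apply/funext => n; exact: normc_sq.
Qed.

Lemma l2normsqE u : l2normsq u = rin u u.
Proof.
rewrite /l2normsq /rin; congr (limn (series _)).
by apply/funext => n; exact: normc_sq.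
Qed.

Lemma dominated_series_cvg (f g : nat -> R) :
  (forall n, `|f n| <= g n) -> cvgn (series g) -> cvgn (series f).
Proof.
move=> fg cg; apply: normed_cvg; rewrite /normed_series_of /=.
refine (@series_le_cvg R (fun n => `|f n|) g _ _ _ cg) => // n.
exact: le_trans (fg n).
Qed.

Lemma cvg_rdot u v : l2 u -> l2 v -> cvgn (series (fun n => rdot (u n) (v n))).
Proof.
move=> /l2P[_ hu] /l2P[_ hv].
have /dominated_series_cvg := fun n => rdot_bound (u n) (v n); apply.
exact: (is_cvg_seriesD hu hv).
Qed.

Lemma rinC u v : rin u v = rin v u.
Proof. by rewrite /rin; congr (limn (series _)); apply/funext => n; rewrite rdotC. Qed.

Lemma series_linE (c : R) (f g : nat -> R) :
  series (fun n => c * f n + g n) = (fun n => c * series f n + series g n).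
Proof. by apply/funext => n; rewrite !seriesEnat/= big_split/= mulr_sumr. Qed.

Lemma l2_lin z u v : l2 u -> l2 v -> l2 (lin z u v).
Proof.
move=> hu hv; have cuv := cvg_rdot hu hv.
move: hu hv => /l2P[u0 hu] /l2P[v0 hv].
apply/l2P; split; first by rewrite /lin u0 v0 mulr0 addr0.
have bound n : `|rdot (lin z u v n) (lin z u v n)| <=
    (2 * rdot z z) * rdot (u n) (u n) + (1 * rdot (v n) (v n) + rdot (v n) (v n)).
  rewrite ger0_norm ?rdot_ge0// /lin; case: z (u n) (v n) => [a b] [x y] [p q].
  rewrite /rdot /=.
  have h1 := sqr_ge0 ((a * x - b * y) - p); have h2 := sqr_ge0 ((a * y + b * x) - q).
  rewrite -subr_ge0; apply: le_trans (addr_ge0 h1 h2) _.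
  by rewrite le_eqVlt; apply/orP; left; apply/eqP; ring.
apply: (dominated_series_cvg bound).
rewrite series_linE; apply: is_cvgD; first by apply: is_cvgM => //; exact: is_cvg_cst.
by rewrite series_linE; apply: is_cvgD => //; apply: is_cvgM => //; exact: is_cvg_cst.
Qed.

Lemma rin_linl (c : R) u v w : l2 u -> l2 v -> l2 w ->
  rin (lin c%:C u v) w = c * rin u w + rin v w.
Proof.
move=> hu hv hw; have cu := cvg_rdot hu hw; have cv := cvg_rdot hv hw.
rewrite /rin /lin.
under eq_fun do rewrite rdot_lin.
rewrite series_linE; apply: cvg_lim => //.
by apply: cvgD => //; apply: cvgM => //; exact: cvg_cst.
Qed.

Lemma rin_linr (c : R) u v w : l2 u -> l2 v -> l2 w ->
  rin w (lin c%:C u v) = c * rin w u + rin w v.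
Proof. by move=> *; rewrite rinC rin_linl// ![rin w _]rinC. Qed.

Lemma rin_lin (c : R) u v : l2 u -> l2 v ->
  rin (lin c%:C u v) (lin c%:C u v) = c ^+ 2 * rin u u + 2 * c * rin u v + rin v v.
Proof.
move=> hu hv; rewrite rin_linl ?rin_linr//; [|exact: l2_lin].
rewrite (rinC v u); ring.
Qed.

Lemma term_le_rin u n : l2 u -> rdot (u n) (u n) <= rin u u.
Proof.
move=> hu.
apply: (@le_trans _ _ (series (fun n => rdot (u n) (u n)) n.+1)).
  by rewrite seriesSr/= lerDr seriesEnat/= sumr_ge0// => i _; exact: rdot_ge0.
apply: nondecreasing_cvgn_le; last exact: cvg_rdot.
apply/nondecreasing_seqP => k.
by rewrite seriesSr/= lerDl rdot_ge0.
Qed.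

Lemma rin_ge0 u : l2 u -> 0 <= rin u u.
Proof. by move=> /(term_le_rin 0); apply: le_trans; exact: rdot_ge0. Qed.

Lemma rin_eq0 u : l2 u -> rin u u = 0 -> u = fun=> 0.
Proof.
move=> hu h0; apply/funext => n; apply: Normc.eq0_normc; apply/eqP.
rewrite -sqrf_eq0 normc_sq eq_le rdot_ge0 andbT -h0; exact: term_le_rin.
Qed.

Lemma finsupp_l2 u : finitely_supported u -> l2 u.
Proof.
move=> [u0 [N uN]]; apply/l2P; split => //; apply: cvgP.
by apply: (@series_eventually0 _ _ N) => k /uN ->; rewrite /rdot /= !mul0r addr0.
Qed.

Lemma finsupp_basis n : finitely_supported (ebasis n).
Proof.
split; first by rewrite /ebasis; case: n.
by exists n.+1 => k nk; rewrite /ebasis gtn_eqF// andbF.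
Qed.

Lemma l2_basis n : l2 (ebasis n). Proof. exact/finsupp_l2/finsupp_basis. Qed.

Lemma l2_0 : l2 (fun=> 0 : R[i]).
Proof. by apply: finsupp_l2; split => //; exists 0%N. Qed.

Lemma finsupp_lin z u v : finitely_supported u -> finitely_supported v ->
  finitely_supported (lin z u v).
Proof.
move=> [u0 [N hu]] [v0 [M hv]]; split; first by rewrite /lin u0 v0 mulr0 addr0.
exists (maxn N M) => k; rewrite geq_max => /andP[Nk Mk].
by rewrite /lin hu// hv// mulr0 addr0.
Qed.

Lemma rin_basis u n : (0 < n)%N -> rin u (ebasis n) = complex.Re (u n).
Proof.
move=> n0; apply: cvg_lim => //.
have -> : complex.Re (u n) = series (fun k => rdot (u k) (ebasis n k)) n.+1.
  rewrite seriesSr/= seriesEnat/= big_nat big1.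
    by rewrite add0r /ebasis eqxx n0 /rdot /= mulr1 mulr0 addr0.
  by move=> i /andP[_ lin]; rewrite /ebasis ltn_eqF// andbF /rdot /= !mulr0 addr0.
apply: series_eventually0 => k nk.
by rewrite /ebasis gtn_eqF// andbF /rdot /= !mulr0 addr0.
Qed.

Lemma rin0l u : rin (fun=> 0) u = 0.
Proof.
apply: cvg_lim => //.
have := @series_eventually0 R (fun k => rdot 0 (u k)) 0%N.
rewrite seriesEnat/= big_geq//; apply => k _.
by rewrite /rdot /= !mul0r addr0.
Qed.

Lemma cvg_complex (x y : nat -> R) (p q : R) :
  x @ \oo --> p -> y @ \oo --> q ->
  (fun n => (x n +i* y n : R[i]^o)) @ \oo --> (p +i* q : R[i]^o).
Proof.
move=> xp yq; apply/cvgrPdist_lt => e e0.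
have [r r0 er] : exists2 r : R, 0 < r & e = r%:C.
  move: e0; rewrite ltcE /= => /andP[/eqP im0 re0]; exists (complex.Re e) => //.
  by case: e im0 re0 => a b /= ->.
have h2 : 0 < r / 2 by rewrite divr_gt0.
move/cvgrPdist_lt : xp => /(_ _ h2) xp; move/cvgrPdist_lt : yq => /(_ _ h2) yq.
near=> n.
rewrite er; apply: (@le_lt_trans _ _ (`|p - x n| + `|q - y n|)%:C); last first.
  by rewrite ltcR (splitr r) ltrD//; near: n.
rewrite normc_def lecR /=.
rewrite -(@ler_pXn2r _ 2)// ?nnegrE ?sqrtr_ge0 ?addr_ge0//.
rewrite sqr_sqrtr ?addr_ge0 ?sqr_ge0// [leRHS]sqrrD !real_normK ?num_real//.
by rewrite lerD// lerDl mulrn_wge0// mulr_ge0.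
Unshelve. all: by end_near. Qed.

Lemma re_inner u v : l2 u -> l2 v -> complex.Re (inner u v) = rin u v.
Proof.
move=> hu hv; have h1 := cvg_rdot hu hv.
have hi : l2 (lin 'i%C v (fun=> 0)) by apply: l2_lin => //; exact: l2_0.
have h2 := cvg_rdot hu hi.
suff -> : inner u v = rin u v +i* (rin u (lin 'i%C v (fun=> 0))) by [].
rewrite /inner.
have -> : series (fun n => u n * (v n)^* : R[i]^o) = fun n =>
    (series (fun n => rdot (u n) (v n)) n +i*
     series (fun n => rdot (u n) (lin 'i%C v (fun=> 0) n)) n : R[i]^o).
  apply/funext => n; elim: n => [|n IH]; first by rewrite !seriesEnat/= !big_geq.
  rewrite !seriesSr/= IH /lin.
  by case: (u n) (v n) => [a b] [p q]; apply/eqP; rewrite eq_complex /rdot /=;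
    apply/andP; split; apply/eqP; ring.
have h := @cvg_lim (R[i]^o) (@norm_hausdorff _ _) _ _ _ _ _ (cvg_complex h1 h2).
exact: h.
Qed.

End RealInnerProduct.

Section JacobiGraph.
Variables (R : realType) (a d : nat -> R).
Implicit Types (u v w f : nat -> R[i]) (z : R[i]).
Local Notation J := (jacobi_expr a d).
Local Notation T := (jacobi_op a d).

Lemma jacobi_lin z u v : J (lin z u v) = lin z (J u) (J v).
Proof.
apply/funext => -[|[|n]]; rewrite /lin /=; [by rewrite mulr0 addr0|ring|ring].
Qed.

Lemma finsupp_jacobi u : finitely_supported u -> finitely_supported (J u).
Proof.
move=> [u0 [N hu]]; split => //; exists N.+2 => -[|[|k]]// Nk.
by rewrite /= !hu ?mulr0 ?addr0//; lia.
Qed.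

Lemma basisS n k : ebasis R n.+1 k.+1 = (k == n)%:R.
Proof. by rewrite /ebasis /= eqSS; case: eqP. Qed.

Lemma jacobi_basis n :
  J (ebasis R n.+1) = lin (a n)%:C (ebasis R n)
    (lin (d n.+1)%:C (ebasis R n.+1) (lin (a n.+1)%:C (ebasis R n.+2) (fun=> 0))).
Proof.
apply/funext => k; rewrite /lin.
have up (m : nat) : (a m.+2)%:C * ebasis R n.+1 m.+3 = (a n)%:C * ebasis R n m.+2.
  case: n => [|n]; first by rewrite /ebasis /= !mulr0.
  by rewrite !basisS eqSS; case: (eqVneq m.+1 n) => [<-//|_]; rewrite !mulr0.
have down (m : nat) : (a m.+1)%:C * ebasis R n.+1 m.+1 = (a n.+1)%:C * ebasis R n.+2 m.+2.
  by rewrite !basisS eqSS; case: (eqVneq m n) => [->//|_]; rewrite !mulr0.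
have diag (m : nat) : (d m.+1)%:C * ebasis R n.+1 m.+1 = (d n.+1)%:C * ebasis R n.+1 m.+1.
  by rewrite !basisS; case: (eqVneq m n) => [->//|_]; rewrite !mulr0.
case: k => [|[|k]] /=.
- have b0 m : ebasis R m 0%N = 0 by case: m.
  by rewrite !b0 !mulr0 !addr0.
- have up0 : (a 1%N)%:C * ebasis R n.+1 2 = (a n)%:C * ebasis R n 1.
    case: n {up down diag} => [|n]; first by rewrite /ebasis /= !mulr0.
    by rewrite !basisS; case: n => [|n]; rewrite /= ?mulr0.
  have off : ebasis R n.+2 1 = 0 by rewrite basisS.
  by rewrite up0 diag off mulr0 !addr0 addrC.
by rewrite up down diag addr0 addrC [X in _ + X]addrC.
Qed.

Lemma normc_jacobi_le w n : Normc.normc (J w n) <=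
  `|a n.-1| * Normc.normc (w n.-1) + `|d n| * Normc.normc (w n)
  + `|a n| * Normc.normc (w n.+1).
Proof.
have nC (x : R) z : Normc.normc (x%:C * z) = `|x| * Normc.normc z.
  by rewrite Normc.normcM /= expr0n addr0 sqrtr_sqr.
have n0 z : 0 <= Normc.normc z by case: z => x y; rewrite sqrtr_ge0.
case: n => [|[|n]] /=; rewrite -?nC.
- by rewrite expr0n addr0 sqrtr0 !addr_ge0.
- rewrite -addrA; apply: le_trans (le_normcD _ _) _.
  by rewrite lerDr.
by apply: le_trans (le_normcD _ _) _; rewrite lerD2r le_normcD.
Qed.

Lemma normc_le_l2 u n : l2 u -> Normc.normc (u n) <= Num.sqrt (l2normsq u).
Proof.
move=> hu; have n0 : 0 <= Normc.normc (u n) by case: (u n) => x y; rewrite sqrtr_ge0.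
rewrite -(ger0_norm n0) -sqrtr_sqr normc_sq l2normsqE ler_wsqrtr//.
exact: term_le_rin.
Qed.

(** The approximants and their images converge in l2, hence at every index, and
    the value of J at an index involves only three components. *)
Lemma jacobi_opE u f : T u f -> f = J u.
Proof.
move=> [hu hf [v [fv vu Jvf]]].
have pt (w : nat -> nat -> R[i]) n : (forall k, l2 (w k)) ->
    l2normsq (w k) @[k --> \oo] --> (0 : R) ->
    Normc.normc (w k n) @[k --> \oo] --> (0 : R).
  move=> lw w0.
  have : Num.sqrt (l2normsq (w k)) @[k --> \oo] --> (0 : R).
    rewrite -(sqrtr0 R); exact: (cvg_comp _ _ w0 (@sqrt_continuous R 0)).
  apply: squeeze_cvgr (cvg_cst (0 : R)).
  near=> k; rewrite normc_le_l2// andbT.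
  by case: (w k n) => x y; rewrite sqrtr_ge0.
have subE (p q : nat -> R[i]) : p \- q = lin (-1) q p.
  by apply/funext => n; rewrite /lin /= mulN1r addrC.
have lvu k : l2 (v k \- u).
  by rewrite subE; apply: l2_lin => //; exact: finsupp_l2.
have lJf k : l2 (J (v k) \- f).
  by rewrite subE; apply: l2_lin => //; exact/finsupp_l2/finsupp_jacobi.
apply/funext => n; apply/eqP; rewrite -subr_eq0; apply/eqP/Normc.eq0_normc.
pose s k := Normc.normc ((J (v k) \- f) n) +
  (`|a n.-1| * Normc.normc ((v k \- u) n.-1) + `|d n| * Normc.normc ((v k \- u) n)
  + `|a n| * Normc.normc ((v k \- u) n.+1)).
have s0 : s @ \oo --> (0 : R).
  have -> : (0 : R) = 0 + (`|a n.-1| * 0 + `|d n| * 0 + `|a n| * 0) by ring.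
  apply: cvgD; first exact: (pt (fun k => J (v k) \- f) n lJf Jvf).
  have pv m := pt (fun k => v k \- u) m lvu vu.
  apply: cvgD; [apply: cvgD|]; (apply: cvgM; [exact: cvg_cst|exact: pv]).
have le_s k : Normc.normc (f n - J u n) <= s k.
  have -> : f n - J u n = J (v k \- u) n + - (J (v k) \- f) n.
    by rewrite subE jacobi_lin /lin /=; ring.
  rewrite addrC; apply: le_trans (le_normcD _ _) _; rewrite normcN lerD2l.
  exact: normc_jacobi_le.
apply/eqP; rewrite eq_le; apply/andP; split.
  by apply: (cvgr_to_ge s0); near=> k; exact: le_s.
by case: (f n - J u n) => x y; rewrite sqrtr_ge0.
Unshelve. all: by end_near. Qed.

(** Adding z h to all the approximants of u changes neither of the two error
    sequences. *)
Lemma jacobi_op_finsupp_lin z h u f : finitely_supported h -> T u f ->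
  T (lin z h u) (lin z (J h) f).
Proof.
move=> fh [hu hf [v [fv vu Jvf]]]; split.
- by apply: l2_lin => //; exact: finsupp_l2.
- by apply: l2_lin => //; exact/finsupp_l2/finsupp_jacobi.
exists (fun k => lin z h (v k)); split.
- by move=> k; exact: finsupp_lin.
- suff -> : (fun k => l2normsq (lin z h (v k) \- lin z h u)) =
            (fun k => l2normsq (v k \- u)) by [].
  by apply/funext => k; congr l2normsq; apply/funext => n; rewrite /lin /=; ring.
- suff -> : (fun k => l2normsq (J (lin z h (v k)) \- lin z (J h) f)) =
            (fun k => l2normsq (J (v k) \- f)) by [].
  apply/funext => k; congr l2normsq; apply/funext => n.
  by rewrite jacobi_lin /lin /=; ring.
Qed.

Lemma l2normsq_scale z u : l2 u ->
  l2normsq (fun n => z * u n) = Normc.normc z ^+ 2 * l2normsq u.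
Proof.
move=> hu; have cu := cvg_rdot hu hu.
rewrite !l2normsqE normc_sq /rin; apply: cvg_lim => //.
have -> : (fun n => rdot (z * u n) (z * u n)) =
    (fun n => rdot z z * rdot (u n) (u n) + 0).
  by apply/funext => n; case: z (u n) => [x y] [p q]; rewrite /rdot /=; ring.
rewrite series_linE -[X in _ --> X]addr0; apply: cvgD.
  by apply: cvgM => //; exact: cvg_cst.
have := @series_eventually0 R R^o (fun=> 0) 0%N (fun=> fun=> erefl).
by rewrite seriesEnat/= big_geq.
Qed.

Lemma jacobi_op_scale z u f : T u f ->
  T (fun n => z * u n) (fun n => z * f n).
Proof.
move=> [hu hf [v [fv vu Jvf]]].
have scaleE w : (fun n => z * w n) = lin z w (fun=> 0).
  by apply/funext => n; rewrite /lin addr0.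
have subE (p q : nat -> R[i]) : p \- q = lin (-1) q p.
  by apply/funext => n; rewrite /lin /= mulN1r addrC.
split; [by rewrite scaleE; apply: l2_lin => //; exact: l2_0..|].
exists (fun k n => z * v k n); split.
- move=> k; have [v0 [N vN]] := fv k.
  by split; [rewrite v0 mulr0|exists N => n /vN ->; rewrite mulr0].
- have -> : (fun k => l2normsq ((fun n => z * v k n) \- (fun n => z * u n))) =
            (fun k => Normc.normc z ^+ 2 * l2normsq (v k \- u)).
    apply/funext => k; rewrite -l2normsq_scale; last first.
      by rewrite subE; apply: l2_lin => //; exact: finsupp_l2.
    by congr l2normsq; apply/funext => n /=; ring.
  by rewrite -[X in _ --> X](mulr0 (Normc.normc z ^+ 2)); apply: cvgM => //; exact: cvg_cst.
- have -> : (fun k => l2normsq (J (fun n => z * v k n) \- (fun n => z * f n))) =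
            (fun k => Normc.normc z ^+ 2 * l2normsq (J (v k) \- f)).
    apply/funext => k; rewrite -l2normsq_scale; last first.
      by rewrite subE; apply: l2_lin => //; exact/finsupp_l2/finsupp_jacobi.
    congr l2normsq; apply/funext => n /=; rewrite scaleE jacobi_lin /lin /=.
    have -> : J (fun=> 0) n = 0 by case: n => [|[|n]] /=; rewrite ?mulr0 ?addr0.
    ring.
  by rewrite -[X in _ --> X](mulr0 (Normc.normc z ^+ 2)); apply: cvgM => //; exact: cvg_cst.
Qed.

End JacobiGraph.

(** * Localization of the spectral measure *)

Section SpectralMeasure.
Variables (R : realType) (a d : nat -> R) (E : pvm R).
Local Notation J := (jacobi_expr a d).
Local Notation T := (jacobi_op a d).
Local Notation PE := (Defs.proj E).
Hypothesis ET : spectral_measure_of T E.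
Implicit Types (u v w f g h : nat -> R[i]) (B : set (measurableTypeR R)).

Lemma proj_lin B z u v : measurable B -> l2 u -> l2 v ->
  PE B (lin z u v) = lin z (PE B u) (PE B v).
Proof. exact: proj_linear. Qed.

Lemma proj_0 B : measurable B -> PE B (fun=> 0) = fun=> 0.
Proof.
move=> mB; have := proj_lin (-1) mB (l2_0 R) (l2_0 R).
have -> : lin (-1) (fun=> 0) (fun=> 0) = (fun=> 0 : R[i]).
  by apply/funext => n; rewrite /lin mulr0 addr0.
by move=> ->; apply/funext => n; rewrite /lin mulN1r addNr.
Qed.

Lemma smeas_rin B u : measurable B -> l2 u ->
  smeas E u B = (rin (PE B u) (PE B u))%:E.
Proof. by move=> mB hu; rewrite smeasE// l2normsqE. Qed.

Lemma smeas_lt_pinfty B u : measurable B -> l2 u -> (smeas E u B < +oo)%E.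
Proof. by move=> mB hu; rewrite smeas_rin// ltry. Qed.

Lemma proj_set0 u : l2 u -> PE set0 u = fun=> 0.
Proof.
move=> hu; apply: rin_eq0; first exact: (@proj_l2 R E).
by have := smeas_rin measurable0 hu; rewrite measure0 => -[].
Qed.

Lemma rin_proj B u v : measurable B -> l2 u -> l2 v ->
  rin (PE B u) v = rin u (PE B v).
Proof.
move=> mB hu hv; rewrite -!re_inner//; [|exact: (@proj_l2 R E)..].
by rewrite proj_sym.
Qed.

Lemma proj_idem B u : measurable B -> l2 u -> PE B (PE B u) = PE B u.
Proof. by move=> mB hu; rewrite -proj_setI// setIid. Qed.

Lemma rin_proj_self B u : measurable B -> l2 u ->
  rin u (PE B u) = rin (PE B u) (PE B u).
Proof.
by move=> mB hu; rewrite [RHS]rin_proj ?proj_idem//; exact: (@proj_l2 R E).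
Qed.

(** The domain condition is a second moment, and |x| <= 1 + x^2. *)
Lemma integrable_id u f : T u f -> (smeas E u).-integrable setT (EFin \o id).
Proof.
move=> Tuf; have hu : l2 u by case: Tuf.
have /ET.1[/(_ _)fin _] := hu.
have {}fin := fin (ex_intro _ f Tuf).
have mid : measurable_fun setT (fun x : measurableTypeR R => x) by [].
have msq : measurable_fun setT (fun x : measurableTypeR R => ((x ^+ 2)%:E : \bar R)).
  by apply/measurable_EFinP; exact: measurable_funX.
apply/integrableP; split; first exact/measurable_EFinP.
apply: (@le_lt_trans _ _ (\int[smeas E u]_x (1 + (x ^+ 2)%:E))%E).
  apply: ge0_le_integral => //.
  - by apply: measurableT_comp => //; exact/measurable_EFinP.
  - by apply: emeasurable_funD.
  - move=> x _; rewrite /= -EFinD lee_fin.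
    have := sqr_ge0 (`|x| - 1 / 2); rewrite -(real_normK (num_real x)).
    rewrite sqrrB; lra.
rewrite ge0_integralD//; last by move=> x _; rewrite lee_fin sqr_ge0.
rewrite integral_cst// mul1e lte_add_pinfty//.
exact: smeas_lt_pinfty.
Qed.

Lemma first_moment u f : T u f -> rin f u = \int[smeas E u]_x x.
Proof.
move=> Tuf; have [hu hf _] := Tuf.
by rewrite -re_inner// (ET.2 _ _ Tuf).
Qed.

(** The scalar measure of PE B w is carried by the bounded set B. *)
Lemma bounded_proj_dom B w (M : R) : measurable B -> l2 w ->
  (forall x, B x -> `|x| <= M) -> exists f, T (PE B w) f.
Proof.
move=> mB hw BM; have hg : l2 (PE B w) by exact: (@proj_l2 R E).
apply/(ET.1 _ hg).
have msq (D : set (measurableTypeR R)) :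
    measurable_fun D (fun x : measurableTypeR R => ((x ^+ 2)%:E : \bar R)).
  by apply/measurable_EFinP; exact: measurable_funX.
have null : smeas E (PE B w) (~` B) = 0%E.
  rewrite smeas_rin//; last exact: measurableC.
  by rewrite -proj_setI// ?setICl ?proj_set0 ?rin0l//; exact: measurableC.
rewrite (ge0_negligible_integral _ _ _ _ null)//=; [|exact: measurableC|by move=> x _; rewrite lee_fin sqr_ge0].
rewrite setTD setCK.
apply: (@le_lt_trans _ _ (\int[smeas E (PE B w)]_(x in B) (M ^+ 2)%:E)%E).
  apply: ge0_le_integral => //.
  - by move=> x _; rewrite lee_fin sqr_ge0.
  - by move=> x Bx; rewrite lee_fin -(real_normK (num_real x)) ler_pXn2r ?nnegrE// ?BM// (le_trans _ (BM _ Bx)).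
by rewrite integral_cst//= lte_mul_pinfty// ?lee_fin ?sqr_ge0// smeas_lt_pinfty.
Qed.

Lemma first_moment_on u f B lambda delta : T u f -> measurable B ->
  (forall x, B x -> lambda - delta <= x <= lambda + delta) ->
  let m := rin (PE B u) (PE B u) in
  (lambda - delta) * m <= \int[smeas E u]_(x in B) x <= (lambda + delta) * m.
Proof.
move=> Tuf mB Bd /=; have hu : l2 u by case: Tuf.
have iB : (smeas E u).-integrable B (EFin \o id).
  by apply: integrableS (integrable_id Tuf).
have ic (c : R) : (smeas E u).-integrable B (EFin \o cst c).
  apply: measurable_bounded_integrable => //; first exact: smeas_lt_pinfty.
  exact: bounded_cst.
have cE (c : R) : c * rin (PE B u) (PE B u) = \int[smeas E u]_(x in B) c.
  by rewrite Rintegral_cst// smeas_rin.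
rewrite !cE; apply/andP; split; apply: le_Rintegral => //; try exact: ic.
- by move=> x /Bd /andP[].
- by move=> x /Bd /andP[].
Qed.

(** Polarization of the form of J - lambda.  The vectors h + g and - h + g have
    the same scalar spectral measure off B, because E(B) g = g; so the difference
    of their forms only sees B, where x - lambda has absolute value at most
    delta.  The bound then follows from the parallelogram law. *)
Lemma form_difference g h f B lambda delta : measurable B ->
  (forall x, B x -> lambda - delta <= x <= lambda + delta) ->
  T g f -> PE B g = g -> finitely_supported h ->
  2 * (rin f h + rin (J h) g - 2 * lambda * rin g h) <=
  2 * delta * (rin g g + rin (PE B h) (PE B h)).
Proof.
move=> mB Bd Tgf Bg fh; have [hg hf _] := Tgf.
have hh := finsupp_l2 fh; have hJ := finsupp_l2 (finsupp_jacobi a d fh).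
have mC : measurable (~` B) by exact: measurableC.
pose u (s : R) := lin s%:C h g; pose k (s : R) := lin s%:C (J h) f.
have Tu s : T (u s) (k s) by exact: jacobi_op_finsupp_lin.
have hu s : l2 (u s) by exact: l2_lin.
have split_int s : rin (k s) (u s) =
    \int[smeas E (u s)]_(x in B) x + \int[smeas E (u s)]_(x in ~` B) x.
  rewrite (first_moment (Tu s)) -(setvU B) setUC Rintegral_setU//.
    by rewrite setUCr; exact: integrable_id (Tu s).
  by apply/disj_setPS => x [].
have off s A : measurable A -> A `<=` ~` B ->
    PE A (u s) = lin s%:C (PE A h) (fun=> 0).
  move=> mA AB; rewrite proj_lin//; congr lin.
  rewrite -Bg -proj_setI//.
  have -> : A `&` B = set0 by apply/disjoints_subset.
  exact: proj_set0.
have offm A : measurable A -> A `<=` ~` B -> smeas E (u 1) A = smeas E (u (-1)) A.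
  move=> mA AB; rewrite !smeas_rin// !off// !rin_lin ?rin0l//; last 4 first.
  - exact: (@proj_l2 R E).
  - exact: l2_0.
  - exact: (@proj_l2 R E).
  - exact: l2_0.
  by rewrite sqrrN ![rin _ (fun=> 0)]rinC !rin0l !mulr0.
have offI : \int[smeas E (u 1)]_(x in ~` B) x = \int[smeas E (u (-1))]_(x in ~` B) x.
  by rewrite /Rintegral (eq_measure_integral _ offm).
have projB s : PE B (u s) = lin s%:C (PE B h) g.
  by rewrite proj_lin// Bg.
have hBh : l2 (PE B h) by exact: (@proj_l2 R E).
have := first_moment_on (Tu 1) mB Bd; have := first_moment_on (Tu (-1)) mB Bd.
rewrite /= !projB !rin_lin//.
have := split_int 1; have := split_int (-1); rewrite offI /k /u !rin_linl ?rin_linr//; try exact: l2_lin.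
have -> : rin (PE B h) g = rin g h by rewrite rin_proj// Bg rinC.
set I := \int[_]_(x in ~` B) x; set I1 := \int[_]_(x in B) x; set I2 := \int[_]_(x in B) x.
rewrite sqrrN expr1n.
move=> e1 e2 /andP[h1 h2] /andP[h3 h4]; lra.
Qed.

(** E(B) (J - lambda) h is bounded by delta E(B) h in norm: apply
    form_difference to g = s E(B) (J - lambda) h and move J from g to h by
    symmetry.  The left-hand side becomes 4 s |E(B) (J - lambda) h|^2, and
    s = 1 / delta is the optimal scaling. *)
Lemma proj_jacobi_le B (lambda delta : R) h : measurable B -> 0 < delta ->
  (forall x, B x -> lambda - delta <= x <= lambda + delta) ->
  finitely_supported h ->
  (forall w f, T w f -> rin f h = rin w (J h)) ->
  rin (PE B (lin (- lambda)%:C h (J h))) (PE B (lin (- lambda)%:C h (J h))) <=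
  delta ^+ 2 * rin (PE B h) (PE B h).
Proof.
move=> mB d0 Bd fh sym; set k := lin _ h _.
have hh := finsupp_l2 fh; have hJ := finsupp_l2 (finsupp_jacobi a d fh).
have hk : l2 k by exact: l2_lin.
have hPk : l2 (PE B k) by exact: (@proj_l2 R E).
pose s := delta^-1.
pose w := lin s%:C k (fun=> 0); have hw : l2 w by apply: l2_lin => //; exact: l2_0.
have [f Tf] : exists f, T (PE B w) f.
  apply: (@bounded_proj_dom _ _ (`|lambda| + delta)) => // x /Bd.
  have := ler_norm lambda; have := ler_norm (- lambda); rewrite normrN => h1 h2 h3.
  by rewrite ler_norml; apply/andP; lra.
have := form_difference mB Bd Tf (proj_idem mB hw) fh.
rewrite (sym _ _ Tf) (rinC (J h)).
have hg : l2 (PE B w) by exact: (@proj_l2 R E).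
have -> : rin (PE B w) (J h) + rin (PE B w) (J h) - 2 * lambda * rin (PE B w) h =
    2 * rin (PE B w) k.
  by rewrite /k rin_linr//; ring.
have gE : PE B w = lin s%:C (PE B k) (fun=> 0) by rewrite proj_lin ?proj_0//; exact: l2_0.
rewrite {1}gE rin_linl ?rin0l//; last exact: l2_0.
have -> : rin (PE B w) (PE B w) = s ^+ 2 * rin (PE B k) (PE B k).
  rewrite gE rin_lin//; last exact: l2_0.
  by rewrite [rin _ (fun=> 0)]rinC !rin0l; ring.
rewrite rinC rin_proj_self//.
set G := rin _ _; set H := rin _ _ => ineq.
have ds : delta * s = 1 by rewrite divff// gt_eqF.
have e : delta * (2 * (2 * (s * G + 0))) = 4 * (delta * s) * G by ring.
have e' : delta * (2 * delta * (s ^+ 2 * G + H)) =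
  2 * (delta * s) ^+ 2 * G + 2 * (delta ^+ 2 * H) by ring.
move: ineq; rewrite -(ler_pM2l d0) e e' ds; lra.
Qed.

End SpectralMeasure.

(** * Orthogonal polynomials and generalized eigenfunctions *)

Section OrthogonalPolynomials.
Variables (R : realType) (a d : nat -> R).

(** The pair (P n, P (n+1)), which makes the two-step recursion structural. *)
Fixpoint opoly_pair (x : R) (n : nat) : R * R :=
  if n is m.+1 then
    let pq := opoly_pair x m in (pq.2, ((x - d m.+1) * pq.2 - a m * pq.1) / a m.+1)
  else (0, 1).

Definition opoly (n : nat) (x : R) : R := (opoly_pair x n).1.

Lemma opoly0 x : opoly 0 x = 0. Proof. by []. Qed.

Lemma opoly1 x : opoly 1 x = 1. Proof. by []. Qed.

Lemma opolySS n x :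
  opoly n.+2 x = ((x - d n.+1) * opoly n.+1 x - a n * opoly n x) / a n.+1.
Proof. by []. Qed.

Lemma opoly_rec n x : a n.+1 != 0 ->
  a n * opoly n x + d n.+1 * opoly n.+1 x + a n.+1 * opoly n.+2 x = x * opoly n.+1 x.
Proof. by move=> an; rewrite opolySS; field. Qed.

Lemma measurable_opoly n : measurable_fun [set: measurableTypeR R] (opoly n).
Proof.
suff [] : measurable_fun [set: measurableTypeR R] (opoly n) /\
  measurable_fun [set: measurableTypeR R] (opoly n.+1) by [].
elim: n => [|n [m0 m1]]; first by split; exact: measurable_cst.
split => //.
have -> : opoly n.+2 = (fun x => ((x - d n.+1) * opoly n.+1 x - a n * opoly n x) / a n.+1).
  by apply/funext => x; rewrite opolySS.
apply: measurable_funM; last exact: measurable_cst.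
apply: measurable_funB; apply: measurable_funM => //.
exact: measurable_funB.
Qed.

Lemma opoly_bounded M n : exists2 K, 0 <= K & forall x, `|x| <= M -> `|opoly n x| <= K.
Proof.
case: (leP 0 M) => M0; last first.
  by exists 0 => // x xM; have := le_lt_trans (le_trans (normr_ge0 x) xM) M0; rewrite ltxx.
suff [[K K0 h] _] : (exists2 K, 0 <= K & forall x, `|x| <= M -> `|opoly n x| <= K) /\
    (exists2 K, 0 <= K & forall x, `|x| <= M -> `|opoly n.+1 x| <= K) by exists K.
elim: n => [|n [[K K0 hK] [L L0 hL]]].
  split; first by exists 0 => // x _; rewrite opoly0 normr0.
  by exists 1 => // x _; rewrite opoly1 normr1.
split; first by exists L.
exists (((M + `|d n.+1|) * L + `|a n| * K) / `|a n.+1|).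
  by rewrite divr_ge0// addr_ge0// mulr_ge0// addr_ge0.
move=> x xM; rewrite opolySS normrM normfV ler_wpM2r ?invr_ge0//.
apply: le_trans (ler_normB _ _) _; rewrite !normrM.
apply: lerD; apply: ler_pM => //; [|exact: hL|exact: hK].
by apply: le_trans (ler_normB _ _) _; rewrite lerD2r.
Qed.

End OrthogonalPolynomials.

Section SpectralPolynomials.
Variables (R : realType) (a d : nat -> R) (E : pvm R).
Local Notation J := (jacobi_expr a d).
Local Notation T := (jacobi_op a d).
Local Notation PE := (Defs.proj E).
Local Notation P := (opoly a d).
Local Notation e := (ebasis R).
Hypothesis ET : spectral_measure_of T E.
Hypothesis a_neq0 : forall n, a n.+1 != 0.
Implicit Types (u v w f g h : nat -> R[i]) (B : set (measurableTypeR R)).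

Lemma basis0E : e 0 = fun=> 0.
Proof. by apply/funext => k. Qed.

Lemma rin_basis_self_le n : rin (e n) (e n) <= 1.
Proof.
case: n => [|n]; first by rewrite basis0E rin0l.
by rewrite rin_basis// basisS eqxx.
Qed.

(** Symmetry of the Jacobi operator, tested against a unit vector. *)
Lemma rin_jacobi_basis n w f : T w f -> rin f (e n.+1) = rin w (J (e n.+1)).
Proof.
move=> Twf; have [hw _ _] := Twf; rewrite (jacobi_opE Twf) rin_basis// jacobi_basis.
have l0 := @l2_0 R; have lb := @l2_basis R.
have re (c : R) z : complex.Re (c%:C * z) = c * complex.Re z.
  by case: z => x y /=; rewrite mul0r subr0.
have reD (z z' : R[i]) : complex.Re (z + z') = complex.Re z + complex.Re z'.
  by case: z; case: z'.
rewrite !rin_linr ?(rin_basis w (ltn0Sn _))//; try by do ?apply: l2_lin.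
rewrite [rin w (fun=> 0)]rinC rin0l.
case: n => [|n]; last by rewrite rin_basis//= !reD !re; ring.
by rewrite basis0E rinC rin0l /= !reD !re; ring.
Qed.

Lemma rin_lin_le (c : R) u v : l2 u -> l2 v ->
  rin (lin c%:C u v) (lin c%:C u v) <= 2 * c ^+ 2 * rin u u + 2 * rin v v.
Proof.
move=> hu hv.
have : 0 <= rin (lin (- c)%:C u v) (lin (- c)%:C u v).
  by apply: rin_ge0; exact: l2_lin.
rewrite !rin_lin//; lra.
Qed.

(** The vectors v n = E(B) e_n - P n lambda E(B) e_1 satisfy the recurrence of
    J - lambda up to the error E(B) (J - lambda) e_n, which proj_jacobi_le
    bounds by delta |E(B) e_n|.  As v 0 = v 1 = 0, all of them are of order
    delta, with constants that are uniform for lambda in a bounded interval. *)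
Lemma basis_approx M n : 0 < M -> exists2 C, 0 <= C &
  forall B lambda delta, measurable B -> 0 < delta -> delta <= M -> `|lambda| <= M ->
  (forall x, B x -> lambda - delta <= x <= lambda + delta) ->
  let v := lin (- P n lambda)%:C (PE B (e 1)) (PE B (e n)) in
  rin v v <= C * delta ^+ 2 * rin (PE B (e 1)) (PE B (e 1)).
Proof.
move=> M0.
pose claim n := exists2 C, 0 <= C &
  forall B lambda delta, measurable B -> 0 < delta -> delta <= M -> `|lambda| <= M ->
  (forall x, B x -> lambda - delta <= x <= lambda + delta) ->
  rin (lin (- P n lambda)%:C (PE B (e 1)) (PE B (e n)))
      (lin (- P n lambda)%:C (PE B (e 1)) (PE B (e n))) <=
    C * delta ^+ 2 * rin (PE B (e 1)) (PE B (e 1)).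
suff [] : claim n /\ claim n.+1 by [].
have lb := @l2_basis R; have l0 := @l2_0 R.
elim: n => [|n [[C0 C00 h0] [C1 C10 h1]]].
  split; exists 0 => // B lambda delta mB d0 dM lM Bd.
    rewrite basis0E proj_0// opoly0.
    have -> : lin (- 0)%:C (PE B (e 1)) (fun=> 0) = fun=> 0.
      by apply/funext => k; rewrite /lin oppr0 mul0r addr0.
    by rewrite rin0l !mul0r.
  rewrite opoly1.
  have -> : lin (- 1)%:C (PE B (e 1)) (PE B (e 1)) = fun=> 0.
    by apply/funext => k; rewrite /lin rmorphN1 mulN1r addNr.
  by rewrite rin0l !mul0r.
split; first by exists C1.
have [K K0 hK] := opoly_bounded a d M n.+1.
pose s := (a n.+1)^-1; pose A := M + `|d n.+1|; pose r := - a n * s.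
exists (4 * s ^+ 2 * (K ^+ 2 + C1 * M ^+ 2) + 4 * (A * s) ^+ 2 * C1 + 8 * r ^+ 2 * C0).
  by do ?[exact: sqr_ge0 | exact: ler0n | exact: C00 | exact: C10 | apply: addr_ge0 | apply: mulr_ge0].
move=> B lambda delta mB d0 dM lM Bd.
have lPb m : l2 (PE B (e m)) by exact: (@proj_l2 R E).
pose D m := lin (- P m lambda)%:C (PE B (e 1)) (PE B (e m)).
have lD m : l2 (D m) by exact: l2_lin.
have {}h0 := h0 B lambda delta mB d0 dM lM Bd.
have {}h1 := h1 B lambda delta mB d0 dM lM Bd.
have key := proj_jacobi_le ET mB d0 Bd (finsupp_basis R n.+1) (@rin_jacobi_basis n).
set k := PE B (lin _ _ _) in key.
have lk : l2 k.
  apply: (@proj_l2 R E) => //; apply: l2_lin => //.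
  exact/finsupp_l2/finsupp_jacobi/finsupp_basis.
pose t := (lambda - d n.+1) * s.
have DE : D n.+2 = lin s%:C k (lin t%:C (D n.+1) (lin r%:C (D n) (fun=> 0))).
  have hC (x : R) : x%:C = x +i* 0 by [].
  rewrite /k jacobi_basis !proj_lin//; try by do ?apply: l2_lin.
  rewrite proj_0//; apply/funext => j; rewrite /D /lin.
  rewrite opolySS /t /r /s.
  rewrite !(rmorphN, rmorphB, rmorphM, fmorphV) /=.
  field.
  by rewrite eq_complex /= eqxx andbT; exact: a_neq0.
rewrite -/(D n) in h0; rewrite -/(D n.+1) in h1; rewrite -/(D n.+2) DE.
set m := rin (PE B (e 1)) (PE B (e 1)) in h0 h1 *.
have m0 : 0 <= m by exact: rin_ge0.
have eE : PE B (e n.+1) = lin (P n.+1 lambda)%:C (PE B (e 1)) (D n.+1).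
  by apply/funext => j; rewrite /D /lin rmorphN /=; ring.
have he : rin (PE B (e n.+1)) (PE B (e n.+1)) <= 2 * (K ^+ 2 + C1 * M ^+ 2) * m.
  rewrite eE; apply: le_trans (rin_lin_le _ _ _) _ => //.
  have -> : 2 * (K ^+ 2 + C1 * M ^+ 2) * m = 2 * K ^+ 2 * m + 2 * (C1 * M ^+ 2 * m) by ring.
  apply: lerD.
    rewrite ler_wpM2r// ler_wpM2l// -(real_normK (num_real (P _ _))).
    by rewrite ler_pXn2r ?nnegrE// hK.
  rewrite ler_wpM2l//; apply: le_trans h1 _.
  by rewrite ler_wpM2r// ler_wpM2l// ler_pXn2r ?nnegrE// ltW.
apply: le_trans (rin_lin_le _ _ _) _ => //; first by do !apply: l2_lin.
have tA : t ^+ 2 <= (A * s) ^+ 2.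
  rewrite /t !exprMn ler_wpM2r ?sqr_ge0// -(real_normK (num_real (_ - _))).
  rewrite ler_pXn2r ?nnegrE//; last by rewrite /A addr_ge0// ltW.
  by apply: le_trans (ler_normB _ _) _; rewrite lerD2r.
have hD : rin (lin t%:C (D n.+1) (lin r%:C (D n) (fun=> 0)))
              (lin t%:C (D n.+1) (lin r%:C (D n) (fun=> 0))) <=
    2 * (A * s) ^+ 2 * (C1 * delta ^+ 2 * m) + 4 * r ^+ 2 * (C0 * delta ^+ 2 * m).
  apply: le_trans (rin_lin_le _ _ _) _ => //; first exact: l2_lin.
  apply: lerD.
    apply: ler_pM => //; [by rewrite mulr_ge0 ?sqr_ge0|exact: rin_ge0|by rewrite ler_wpM2l].
  have := rin_lin_le r (lD n) l0; rewrite rin0l => hr.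
  have := ler_wpM2l (sqr_ge0 r) h0; lra.
have hk := ler_wpM2l (sqr_ge0 delta) he.
have hs := ler_wpM2l (sqr_ge0 s) (le_trans key hk).
have -> : (4 * s ^+ 2 * (K ^+ 2 + C1 * M ^+ 2) + 4 * (A * s) ^+ 2 * C1 + 8 * r ^+ 2 * C0) *
    delta ^+ 2 * m = 2 * (s ^+ 2 * (delta ^+ 2 * (2 * (K ^+ 2 + C1 * M ^+ 2) * m))) +
    2 * (2 * (A * s) ^+ 2 * (C1 * delta ^+ 2 * m) + 4 * r ^+ 2 * (C0 * delta ^+ 2 * m)) by ring.
apply: lerD; last by rewrite ler_wpM2l.
by rewrite -mulrA ler_wpM2l.
Qed.

End SpectralPolynomials.

Section GeneralizedEigenfunctions.
Variables (R : realType) (a d : nat -> R) (E : pvm R).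
Local Notation T := (jacobi_op a d).
Local Notation PE := (Defs.proj E).
Local Notation P := (opoly a d).
Local Notation e := (ebasis R).
Hypothesis ET : spectral_measure_of T E.
Hypothesis a_neq0 : forall n, a n.+1 != 0.

Lemma measurable_opoly_sq n (D : set (measurableTypeR R)) :
  measurable_fun D (fun x : measurableTypeR R => ((P n x ^+ 2)%:E : \bar R)).
Proof.
apply/measurable_EFinP; apply: measurable_funX.
exact: measurable_funS (measurable_opoly a d n).
Qed.

(** On a short interval B, basis_approx applies with any point x of B as
    lambda; thus (P n x)^2 mu_1(B) is at most 2 mu_n(B) up to a small multiple of
    mu_1(B), for every x in B. *)
Lemma opoly_sq_integral_itv (M : R) n (C lambda0 delta : R) : 0 < M -> 0 < delta -> delta <= M ->
  (forall (B : set (measurableTypeR R)) lambda, measurable B -> `|lambda| <= M ->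
    (forall x, B x -> lambda - delta <= x <= lambda + delta) ->
    let v := lin (- P n lambda)%:C (PE B (e 1)) (PE B (e n)) in
    rin v v <= C * delta ^+ 2 * rin (PE B (e 1)) (PE B (e 1))) ->
  - M <= lambda0 -> lambda0 + delta <= M ->
  (\int[smeas E (e 1)]_(x in `]lambda0, (lambda0 + delta)%R]) (P n x ^+ 2)%:E <=
   2%:E * smeas E (e n) `]lambda0, (lambda0 + delta)%R]%classic +
   (2 * C * delta ^+ 2)%:E * smeas E (e 1) `]lambda0, (lambda0 + delta)%R]%classic)%E.
Proof.
move=> M0 d0 dM approx Ml lM.
set B : set (measurableTypeR R) := `]lambda0, (lambda0 + delta)]%classic.
have mB : measurable B by exact: measurable_itv.
have lb := @l2_basis R.
have lPb m : l2 (PE B (e m)) by exact: (@proj_l2 R E).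
rewrite !smeas_rin//.
set m := rin (PE B (e 1)) (PE B (e 1)); set mn := rin (PE B (e n)) (PE B (e n)).
have m0 : 0 <= m by exact: rin_ge0.
have pointwise x : B x -> P n x ^+ 2 * m <= 2 * mn + 2 * C * delta ^+ 2 * m.
  rewrite /B /= in_itv/= => /andP[lx xl].
  have xM : `|x| <= M by rewrite ler_norml; apply/andP; lra.
  have Bx y : B y -> x - delta <= y <= x + delta.
    by rewrite /B /= in_itv/= => /andP[ly yl]; apply/andP; lra.
  have := approx B x mB xM Bx; rewrite /= -/m.
  set v := lin _ _ _ => hv.
  have eE : lin (P n x)%:C (PE B (e 1)) (fun=> 0) = lin (- 1)%:C v (PE B (e n)).
    by apply/funext => j; rewrite /v /lin !rmorphN /=; ring.
  have lv : l2 v by exact: l2_lin.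
  have := rin_lin_le (-1) lv (lPb n); rewrite -eE rin_lin//; last exact: l2_0.
  rewrite [rin _ (fun=> 0)]rinC !rin0l -/m -/mn sqrrN expr1n; lra.
rewrite -!EFinM -EFinD.
have [m00|m1] := eqVneq m 0.
  have rB0 : smeas E (e 1) B = 0%E by rewrite smeas_rin// -/m m00.
  rewrite null_set_integral//; last exact: measurable_opoly_sq.
  by rewrite m00 mulr0 addr0 lee_fin mulr_ge0// rin_ge0.
have mp : 0 < m by rewrite lt_neqAle eq_sym m1.
apply: (@le_trans _ _ (\int[smeas E (e 1)]_(x in B) ((2 * mn + 2 * C * delta ^+ 2 * m) / m)%:E)%E).
  apply: ge0_le_integral => //.
  - by move=> x _; rewrite lee_fin sqr_ge0.
  - exact: measurable_opoly_sq.
  - by move=> x Bx; rewrite lee_fin ler_pdivlMr// pointwise.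
rewrite integral_cst//= smeas_rin// -/m -EFinM lee_fin.
by rewrite divfK.
Qed.

Lemma smeas_basis_le1 n B : measurable B -> (smeas E (e n) B <= 1)%E.
Proof.
move=> mB; have lb := @l2_basis R.
apply: (@le_trans _ _ (smeas E (e n) setT)); first by apply: le_measure; rewrite ?inE.
by rewrite smeas_rin// proj_setT// lee_fin rin_basis_self_le.
Qed.

(** The interval is cut into N pieces of length delta, with N so large that the
    error term 2 C delta^2 is at most 2; summing over the pieces leaves
    2 mu_n + 2 mu_1, which has total mass at most 4. *)
Lemma opoly_sq_integral_le (M : R) n : 0 < M ->
  (\int[smeas E (e 1)]_(x in `]0%R, M]) (P n x ^+ 2)%:E <= 4%:E)%E.
Proof.
move=> M0.
have [C C0 approx] := basis_approx ET a_neq0 n M0.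
pose N := (Num.trunc (C * M ^+ 2)).+1.
have N0 : 0 < N%:R :> R by [].
have N1 : 1 <= N%:R :> R by rewrite ler1n.
have CN : C * M ^+ 2 <= N%:R by exact/ltW/truncnS_gt.
pose delta := M / N%:R.
have d0 : 0 < delta by rewrite divr_gt0.
have dM : delta <= M by rewrite ler_pdivrMr// ler_peMr// ltW.
have k0 : 0 <= 2 * C * delta ^+ 2 by apply: mulr_ge0; [exact: mulr_ge0|exact: sqr_ge0].
have claim j : (j <= N)%N ->
    (\int[smeas E (e 1)]_(x in `]0%R, (j%:R * delta)%R]) (P n x ^+ 2)%:E <=
     2%:E * smeas E (e n) `]0%R, (j%:R * delta)%R]%classic +
     (2 * C * delta ^+ 2)%:E * smeas E (e 1) `]0%R, (j%:R * delta)%R]%classic)%E.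
  elim: j => [|j IH] jN.
    rewrite mul0r set_itvoc0 integral_set0.
    by apply: adde_ge0; exact: mule_ge0.
  have j1 : j.+1%:R * delta = j%:R * delta + delta by rewrite -natr1 mulrDl mul1r.
  have jd0 : 0 <= j%:R * delta by rewrite mulr_ge0// ltW.
  have U : `]0%R, (j.+1%:R * delta)]%classic =
      `]0%R, (j%:R * delta)]%classic `|` `](j%:R * delta), (j.+1%:R * delta)]%classic :> set (measurableTypeR R).
    by apply: itv_bndbnd_setU; rewrite bnd_simp// j1 lerDl ltW.
  have dis : [disjoint `]0%R, (j%:R * delta)]%classic & `](j%:R * delta), (j.+1%:R * delta)]%classic].
    apply/disj_setPS => x /=; rewrite !in_itv/= => -[/andP[_ h1] /andP[h2 _]].
    by have := le_lt_trans h1 h2; rewrite ltxx.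
  rewrite U ge0_integral_setU//; first last.
  - by move=> x _; rewrite lee_fin sqr_ge0.
  - exact: measurable_opoly_sq.
  have meas u : smeas E u (`]0%R, (j%:R * delta)]%classic `|` `](j%:R * delta), (j.+1%:R * delta)]%classic) =
      (smeas E u `]0%R, (j%:R * delta)%R]%classic + smeas E u `](j%:R * delta)%R, (j.+1%:R * delta)%R]%classic)%E.
    by rewrite measureU//; exact/disj_set2P.
  rewrite !meas !ge0_muleDr//.
  rewrite [leRHS]addeACA; apply: leeD; first exact: IH (ltnW jN).
  rewrite j1; apply: (@opoly_sq_integral_itv M n C) => //.
  - by move=> B l mB lM Bd; exact: approx.
  - by apply: le_trans jd0; rewrite oppr_le0 ltW.
  - rewrite -j1 /delta mulrCA; apply: ler_piMr; first exact: ltW.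
    by rewrite ler_pdivrMr// mul1r ler_nat.
have := claim N (leqnn N).
have -> : N%:R * delta = M by rewrite /delta mulrCA divff ?mulr1// gt_eqF.
move=> h; apply: le_trans h _.
have c1 : 2 * C * delta ^+ 2 <= 2.
  rewrite -mulrA -[leRHS]mulr1 ler_wpM2l// /delta exprMn exprVn mulrA ler_pdivrMr ?exprn_gt0//.
  rewrite mul1r; apply: le_trans CN _; rewrite expr2 ler_peMr//; exact: ltW.
have -> : 4%:E = (2%:E * 1 + 2%:E * 1)%E :> \bar R by rewrite !mule1 -EFinD; congr EFin; ring.
have mI : measurable (`]0%R, M]%classic : set (measurableTypeR R)) by exact: measurable_itv.
apply: leeD; first by rewrite lee_wpmul2l// smeas_basis_le1.
by apply: lee_pmul => //; exact: smeas_basis_le1.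
Qed.

(** The weights 2^-(j+1) make the series of the integrals converge for any choice
    of the indices k j; monotone convergence does the rest. *)
Lemma opoly_ae_series (k : nat -> nat) (M : R) : 0 < M ->
  {ae smeas E (e 1), forall x, `]0%R, M]%classic x ->
    (\sum_(0 <= j <oo) (P (k j) x ^+ 2 / (2 ^ (j + 1))%:R)%:E)%E \is a fin_num}.
Proof.
move=> M0.
have mI : measurable (`]0%R, M]%classic : set (measurableTypeR R)) by exact: measurable_itv.
pose f j (x : measurableTypeR R) : \bar R := (P (k j) x ^+ 2 / (2 ^ (j + 1))%:R)%:E.
have f0 j x : (0 <= f j x)%E by rewrite lee_fin mulr_ge0 ?sqr_ge0// invr_ge0.
have mf j (D : set (measurableTypeR R)) : measurable_fun D (f j).
  have -> : f j = fun x => ((P (k j) x ^+ 2)%:E * ((2 ^ (j + 1))%:R^-1)%:E)%E.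
    by apply/funext => x; rewrite /f EFinM.
  apply: emeasurable_funM => //; exact: measurable_opoly_sq.
have int_f : (smeas E (e 1)).-integrable `]0%R, M] (fun x => \sum_(0 <= j <oo) f j x)%E.
  apply/integrableP; split.
    by apply: ge0_emeasurable_sum => // j x _ _; exact: f0.
  under eq_integral do rewrite gee0_abs ?nneseries_ge0//.
  rewrite integral_nneseries//.
  apply: (@le_lt_trans _ _ (\sum_(0 <= j <oo) (4 / (2 ^ (j + 1))%:R)%:E)%E).
    apply: lee_nneseries => j _; first by move=> _; apply: integral_ge0 => x _; exact: f0.
    rewrite /f; under eq_integral do rewrite EFinM.
    rewrite ge0_integralZr//; last 2 first.
    - exact: measurable_opoly_sq.
    - by move=> x _; rewrite lee_fin sqr_ge0.
    rewrite EFinM lee_wpmul2r// ?lee_fin ?invr_ge0//.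
    exact: opoly_sq_integral_le.
  have /cvg_lim := @cvg_geometric_eseries_half R 4 0.
  by rewrite /eseries/= => ->//; rewrite ltry.
exact: integrable_ae int_f.
Qed.

End GeneralizedEigenfunctions.

(** * The decaying solutions form a countable family *)

Section Orthogonality.
Variables (R : realType) (a d : nat -> R).
Local Notation P := (opoly a d).
Hypothesis a_neq0 : forall n, a n.+1 != 0.
Hypothesis a_le : forall n, `|a n| <= n%:R.

Definition decaying (x : R) : Prop := exists C, forall k, k%:R * `|P k x| <= C.

Definition gram (x y : R) : nat -> R := series (fun k => P k x * P k y).

(** Green's formula; it starts from P 0 = 0. *)
Lemma gram_green x y n :
  (x - y) * gram x y n.+1 = a n * (P n.+1 x * P n y - P n x * P n.+1 y).
Proof.
rewrite /gram; elim: n => [|n IH].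
  by rewrite seriesSr/= seriesEnat/= big_geq// opoly0 !(mul0r, mulr0, subr0, addr0).
rewrite seriesSr/= mulrDr IH.
have hx := opoly_rec d x (a_neq0 n); have hy := opoly_rec d y (a_neq0 n).
transitivity (a n * (P n.+1 x * P n y - P n x * P n.+1 y) +
   ((x * P n.+1 x) * P n.+1 y - P n.+1 x * (y * P n.+1 y))); first by ring.
by rewrite -hx -hy; ring.
Qed.

(** In the boundary term of Green's formula, a_n = O(n) is compensated by the two
    factors P, which are O(1/n) each. *)
Lemma decaying_orthogonal x y : decaying x -> decaying y -> x != y ->
  gram x y @ \oo --> (0 : R).
Proof.
move=> [C hC] [D hD] xy; rewrite -cvg_shiftS.
have xy0 : 0 < `|x - y| by rewrite normr_gt0 subr_eq0.
have C0 : 0 <= C by apply: le_trans (hC 0%N); rewrite mul0r.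
have D0 : 0 <= D by apply: le_trans (hD 0%N); rewrite mul0r.
have bound n : `|gram x y n.+1| <= (2 * C * D / `|x - y|) * harmonic n.
  rewrite /harmonic /= mulrAC ler_pdivlMr// mulrC -normrM gram_green normrM.
  rewrite ler_pdivlMr ?ltr0n//.
  have h1 : `|a n| * (`|P n.+1 x| * `|P n y|) * n.+1%:R <= C * D.
    have -> : `|a n| * (`|P n.+1 x| * `|P n y|) * n.+1%:R =
      (n.+1%:R * `|P n.+1 x|) * (`|a n| * `|P n y|) by ring.
    by apply: ler_pM => //; apply: le_trans (hD n); rewrite ler_wpM2r.
  have h2 : `|a n| * (`|P n x| * `|P n.+1 y|) * n.+1%:R <= C * D.
    have -> : `|a n| * (`|P n x| * `|P n.+1 y|) * n.+1%:R =
      (`|a n| * `|P n x|) * (n.+1%:R * `|P n.+1 y|) by ring.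
    by apply: ler_pM => //; apply: le_trans (hC n); rewrite ler_wpM2r.
  have h3 : `|P n.+1 x * P n y - P n x * P n.+1 y| <=
      `|P n.+1 x| * `|P n y| + `|P n x| * `|P n.+1 y|.
    by rewrite -!normrM; exact: ler_normB.
  have h4 := ler_wpM2l (normr_ge0 (a n)) h3.
  have h5 := ler_wpM2r (ler0n R n.+1) h4.
  apply: le_trans h5 _; lra.
apply/cvgr0Pnorm_le => eps eps0.
have : (2 * C * D / `|x - y|) * harmonic n @[n --> \oo] --> (0 : R).
  rewrite -[X in _ --> X](mulr0 (2 * C * D / `|x - y|)).
  by apply: cvgM; [exact: cvg_cst|exact: cvg_harmonic].
move/cvgr0Pnorm_le => /(_ _ eps0); apply: filterS => n.
by apply: le_trans; apply: le_trans (bound n) (ler_norm _).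
Qed.

(** 1/k^2 is compared with the telescoping 2/(k (k+1)). *)
Lemma decaying_gram_cvg x : decaying x -> cvgn (gram x x).
Proof.
move=> [C hC]; have C0 : 0 <= C by apply: le_trans (hC 0%N); rewrite mul0r.
have tel : cvgn (series (telescope (fun n => - (2 * C ^+ 2) * harmonic n))).
  rewrite telescopeK; apply: is_cvgB; last exact: is_cvg_cst.
  by apply: is_cvgM; [exact: is_cvg_cst|exact: cvgP cvg_harmonic].
suff bound k : `|P k.+1 x * P k.+1 x| <=
    telescope (fun n => - (2 * C ^+ 2) * harmonic n) k.
  have shifted := dominated_series_cvg bound tel.
  apply: (cvgP (limn (series (fun k => P k.+1 x * P k.+1 x)))).
  rewrite -cvg_shiftS; apply: cvg_trans shifted; apply: near_eq_cvg; apply: nearW => n.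
  by rewrite /gram !seriesEnat/= big_nat_recl// opoly0 mul0r add0r.
rewrite /telescope /harmonic /=.
have hk := hC k.+1.
have sq : k.+1%:R ^+ 2 * (P k.+1 x * P k.+1 x) <= C ^+ 2.
  have -> : k.+1%:R ^+ 2 * (P k.+1 x * P k.+1 x) = (k.+1%:R * `|P k.+1 x|) ^+ 2.
    by rewrite exprMn real_normK ?num_real// expr2.
  by rewrite ler_pXn2r ?nnegrE// mulr_ge0.
rewrite ger0_norm -?expr2 ?sqr_ge0//.
have k0 : 0 < k.+1%:R :> R by []; have k1 : 1 <= k.+1%:R :> R by rewrite ler1n.
have -> : - (2 * C ^+ 2) / k.+2%:R - - (2 * C ^+ 2) / k.+1%:R =
   2 * C ^+ 2 / (k.+1%:R * (k.+1%:R + 1)).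
  by rewrite -[k.+2%:R]natr1; field; rewrite !gt_eqF// addr_gt0.
rewrite ler_pdivlMr; last by rewrite mulr_gt0// addr_gt0.
move: sq; rewrite -expr2; set p := P _ _ ^+ 2 => sq.
have p0 : 0 <= p by rewrite sqr_ge0.
have : p * (k.+1%:R * (k.+1%:R + 1)) <= p * (2 * k.+1%:R ^+ 2).
  rewrite ler_wpM2l// expr2.
  have := ler_wpM2l (ltW k0) k1; lra.
lra.
Qed.

Definition sqnorm (x : R) : R := limn (gram x x).

Lemma sqnorm_ge1 x : decaying x -> 1 <= sqnorm x.
Proof.
move=> /decaying_gram_cvg cx.
apply: (@le_trans _ _ (gram x x 2)).
  by rewrite /gram !seriesSr/= seriesEnat/= big_geq// opoly0 opoly1; lra.
apply: nondecreasing_cvgn_le => //; apply/nondecreasing_seqP => n.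
by rewrite /gram seriesSr/= lerDl -expr2 sqr_ge0.
Qed.

(** Bessel's inequality for the unit vector e_1, whose inner product with every
    solution is P 1 = 1.  It is the nonnegativity of the squared norm of f, the
    difference between e_1 and its projection, computed as the limit of partial
    sums. *)
Lemma bessel (s : seq R) : uniq s -> (forall x, x \in s -> decaying x) ->
  \sum_(x <- s) (sqnorm x)^-1 <= 1.
Proof.
move=> us sd.
pose c x := (sqnorm x)^-1.
pose f (k : nat) := (k == 1%N)%:R - \sum_(x <- s) c x * P k x.
have seriesE n : series (fun k => f k ^+ 2) n.+2 =
    1 - 2 * \sum_(x <- s) c x +
    \sum_(x <- s) \sum_(y <- s) c x * c y * gram x y n.+2.
  have sq k : f k ^+ 2 = (k == 1%N)%:R * (1 - 2 * \sum_(x <- s) c x * P k x) +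
     \sum_(x <- s) \sum_(y <- s) c x * c y * (P k x * P k y).
    rewrite /f sqrrB; set S := \sum_(x <- s) c x * _.
    have -> : \sum_(x <- s) \sum_(y <- s) c x * c y * (P k x * P k y) = S ^+ 2.
      rewrite expr2 /S mulr_suml; apply: eq_bigr => x _; rewrite mulr_sumr.
      by apply: eq_bigr => y _; ring.
    by case: (k == 1%N) => /=; ring.
  rewrite seriesEnat/= (eq_bigr _ (fun k _ => sq k)) big_split/=; congr (_ + _).
    have tail : \sum_(0 <= i < n) (i.+2 == 1%N)%:R *
        (1 - 2 * \sum_(x <- s) c x * P i.+2 x) = 0.
      by rewrite big1// => i _; rewrite mul0r.
    rewrite big_nat_recl// big_nat_recl//= tail mul0r add0r mul1r addr0.
    congr (_ - _ * _); by apply: eq_bigr => x _; rewrite opoly1 mulr1.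
  rewrite exchange_big/=; apply: eq_bigr => x _; rewrite exchange_big/=.
  by apply: eq_bigr => y _; rewrite /gram seriesEnat/= mulr_sumr.
have gram_lim x y : x \in s -> y \in s ->
    gram x y @ \oo --> (if x == y then sqnorm x else 0).
  move=> xs ys; case: eqVneq => [->|xy]; first exact: decaying_gram_cvg (sd _ ys).
  exact: decaying_orthogonal (sd _ xs) (sd _ ys) xy.
have lim : series (fun k => f k ^+ 2) n.+2 @[n --> \oo] -->
    1 - 2 * \sum_(x <- s) c x +
    \sum_(x <- s) \sum_(y <- s) c x * c y * (if x == y then sqnorm x else 0).
  under eq_fun do rewrite seriesE.
  apply: cvgD; first exact: cvg_cst.
  rewrite big_seq; under eq_fun do rewrite big_seq.
  apply: cvg_big; [exact: add_continuous|] => x xs.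
  rewrite big_seq; under eq_fun do rewrite big_seq.
  apply: cvg_big; [exact: add_continuous|] => y ys.
  apply: cvgM; first exact: cvg_cst.
  have := gram_lim x y xs ys; rewrite -(cvg_shiftn 2).
  by under eq_fun do rewrite addn2.
have : 0 <= 1 - 2 * \sum_(x <- s) c x +
    \sum_(x <- s) \sum_(y <- s) c x * c y * (if x == y then sqnorm x else 0).
  apply: (cvgr_to_ge lim); apply: nearW => n.
  by rewrite seriesEnat/= sumr_ge0// => k _; exact: sqr_ge0.
suff -> : \sum_(x <- s) \sum_(y <- s) c x * c y * (if x == y then sqnorm x else 0) =
    \sum_(x <- s) c x by rewrite /c; lra.
rewrite big_seq [RHS]big_seq; apply: eq_bigr => x xs.
rewrite (bigD1_seq x)//= eqxx big1 ?addr0; last first.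
  by move=> y /negbTE yx; rewrite eq_sym yx mulr0.
rewrite -mulrA /c mulVf ?mulr1// gt_eqF//.
by apply: lt_le_trans (sqnorm_ge1 (sd _ xs)).
Qed.

(** By Bessel's inequality at most m+1 decaying solutions have squared norm at
    most m+1. *)
Lemma countable_decaying : countable [set x | decaying x].
Proof.
pose A (m : nat) := [set x | decaying x /\ sqnorm x <= m.+1%:R].
have finA m : finite_set (A m).
  apply: contrapT => /(@infinite_set_fset _ _ m.+2)[B BA mB].
  have Bd x : x \in finmap.enum_fset B -> A m x by move=> xB; exact: BA.
  have := @bessel (finmap.enum_fset B) (finmap.fset_uniq B) (fun x xB => (Bd x xB).1).
  have le x : x \in finmap.enum_fset B -> m.+1%:R^-1 <= (sqnorm x)^-1.
    move=> /Bd[dx xm]; rewrite lef_pV2// posrE//.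
    exact: lt_le_trans (sqnorm_ge1 dx).
  move=> h; have : \sum_(x <- finmap.enum_fset B) (m.+1%:R^-1 : R) <= 1.
    apply: le_trans h; rewrite big_seq [leRHS]big_seq; apply: ler_sum => x; exact: le.
  rewrite big_const_seq count_predT iter_addr_0 -[_ *+ _]mulr_natr mulrC ler_pdivrMr// mul1r.
  by rewrite ler_nat => h2; have := leq_trans mB h2; rewrite ltnn.
have -> : [set x | decaying x] = \bigcup_m A m.
  apply/seteqP; split => [x dx|x [m _ []]//].
  by exists (Num.trunc (sqnorm x)) => //; split => //; exact/ltW/truncnS_gt.
by apply: bigcup_countable => // m _; exact: finite_set_countable.
Qed.

End Orthogonality.

(** * A criterion for pure point spectrum *)

Lemma countable_measure_esum (R : realType)
    (mu : {measure set (measurableTypeR R) -> \bar R}) (D : set (measurableTypeR R)) :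
  countable D -> mu D = \esum_(x in D) mu [set x].
Proof.
move=> /[dup] cD /countable_injP[f fI].
have m1 (x : measurableTypeR R) : measurable [set x] by exact: measurable_set1.
pose F n : set (measurableTypeR R) := [set x | D x /\ f x = n].
have FE n : F n = set0 \/ exists x, F n = [set x].
  have [[x [Dx fx]]|/forallNP F0] := pselect (exists x, F n x); [right|left].
    exists x; apply/seteqP; split => y /=; last by move=> ->.
    by move=> [Dy fy]; apply: fI; rewrite ?inE// fx fy.
  by apply/seteqP; split => // x /F0.
have mF n : measurable (F n) by case: (FE n) => [->|[x ->]].
have tF : trivIset setT F.
  by apply/trivIsetP => i j _ _ ij; apply/disjoints_subset => x [_ fi] [_ fj]; move: ij; rewrite -fi -fj eqxx.
have DF : D = \bigcup_n F n.
  by apply/seteqP; split => [x Dx|x [n _ []]//]; exists (f x).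
rewrite [in RHS]DF esum_bigcupT// -nneseries_esumT; last first.
  by move=> n; exact: esum_ge0.
rewrite [in LHS]DF measure_bigcup//.
rewrite (@eq_eseriesl _ _ xpredT); last by move=> n; rewrite in_setT.
apply: eq_eseriesr => n _.
by case: (FE n) => [->|[x ->]]; rewrite ?measure0 ?esum_set0 ?esum_set1.
Qed.

Section PurePoint.
Variables (R : realType) (a d : nat -> R) (E : pvm R).
Local Notation T := (jacobi_op a d).
Local Notation PE := (Defs.proj E).
Local Notation P := (opoly a d).
Local Notation e := (ebasis R).
Hypothesis ET : spectral_measure_of T E.
Hypothesis a_neq0 : forall n, a n.+1 != 0.

(** The vector e_1 is cyclic: by basis_approx, with the whole set S playing the
    role of a neighbourhood of 0, E(S) e_1 = 0 forces E(S) e_n = 0 for all n, and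
    then E(S) u is orthogonal to every e_n. *)
Lemma smeas_null_of_basis1 M (S : set (measurableTypeR R)) u :
  measurable S -> 0 < M -> (forall x, S x -> `|x| <= M) ->
  smeas E (e 1) S = 0%E -> l2 u -> smeas E u S = 0%E.
Proof.
move=> mS M0 SM S0 hu; have lb := @l2_basis R; have l0 := @l2_0 R.
have rin1 : rin (PE S (e 1)) (PE S (e 1)) = 0 by move: S0; rewrite smeas_rin// => -[].
have P1 : PE S (e 1) = fun=> 0 by apply: rin_eq0 => //; exact: (@proj_l2 R E).
have Pn n : PE S (e n) = fun=> 0.
  have [C C0 /(_ S 0 M mS M0 (lexx _))] := basis_approx ET a_neq0 n M0.
  rewrite normr0 => /(_ (ltW M0)) /=.
  have -> : lin (- P n 0)%:C (PE S (e 1)) (PE S (e n)) = PE S (e n).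
    by apply/funext => k; rewrite P1 /lin mulr0 add0r.
  rewrite rin1 mulr0 => h; apply: rin_eq0; first exact: (@proj_l2 R E).
  apply/eqP; rewrite eq_le rin_ge0 ?h//; last exact: (@proj_l2 R E).
  by move=> x /SM; rewrite ler_norml sub0r add0r.
have re0 v n : l2 v -> complex.Re (PE S v n.+1) = 0.
  by move=> hv; rewrite -rin_basis// rin_proj// Pn rinC rin0l.
have Pu : PE S u = fun=> 0.
  apply/funext => -[|n]; first by have [] := @proj_l2 R E S u mS hu.
  have h1 := re0 u n hu.
  (* the real part of the component of i u is minus the imaginary part for u *)
  have := re0 _ n (l2_lin 'i%C hu l0).
  rewrite proj_lin// proj_0// /lin addr0.
  by case: (PE S u n.+1) h1 => x y /= ->; rewrite mul0r mul1r sub0r => /eqP; rewrite oppr_eq0 => /eqP ->.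
by rewrite smeas_rin// Pu rin0l.
Qed.

(** Outside L the terms of the series in opoly_ae_series do not tend to 0, so the
    complement of L in the positive axis is null for e_1, hence for every u. *)
Lemma pure_point_criterion (L : set (measurableTypeR R)) (k : nat -> nat) :
  countable L ->
  (forall x, 0 < x -> ~ L x ->
    ~ (P (k j) x ^+ 2 / (2 ^ (j + 1))%:R @[j --> \oo] --> (0 : R))) ->
  pure_point_on E [set x : R | 0 < x].
Proof.
move=> cL Lgrow u hu.
have m1 (x : measurableTypeR R) : measurable [set x] by exact: measurable_set1.
have mcount (D : set (measurableTypeR R)) : countable D -> measurable D.
  by move=> cD; exact: countable_measurable.
have mL := mcount _ cL.
pose S (n : nat) : set (measurableTypeR R) := `]0%R, (n.+1%:R : R)]%classic `\` L.
have mS n : measurable (S n).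
  by apply: measurableD => //; exact: measurable_itv.
have S0 n : smeas E (e 1) (S n) = 0%E.
  apply: measure_negligible => //.
  have n0 : 0 < n.+1%:R :> R by [].
  apply: negligibleS (opoly_ae_series ET a_neq0 k n0) => x [xn Lx] /= /(_ xn) fin.
  have x0 : 0 < x by move: xn; rewrite /= in_itv/= => /andP[].
  apply: (Lgrow _ x0 Lx).
  apply: cvg_series_cvg_0; apply: nnseries_is_cvg.
    by move=> j; rewrite mulr_ge0 ?sqr_ge0// invr_ge0.
  by rewrite ltey_eq fin.
have Su n : smeas E u (S n) = 0%E.
  apply: (@smeas_null_of_basis1 n.+1%:R) => // x [].
  by rewrite /= in_itv/= => /andP[x0 xn] _; rewrite gtr0_norm.
have null (D : set (measurableTypeR R)) : measurable D ->
    D `<=` [set x | 0 < x] `\` L -> smeas E u D = 0%E.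
  move=> mD DL; apply: measure_negligible => //.
  apply: (@negligibleS _ _ _ _ (\bigcup_n S n)).
    move=> x /DL[/= x0 Lx]; exists (Num.trunc x) => //; split => //=.
    by rewrite in_itv/= x0/= ltW// truncnS_gt.
  by apply: negligible_bigcup => n; exists (S n); split.
move=> B mB B0.
rewrite (esumID L)//.
have -> : \esum_(x in B `&` ~` L) smeas E u [set x] = 0%E.
  apply: esum1 => x [Bx Lx]; apply: null => // y ->; split => //; exact: B0.
have cBL : countable (B `&` L).
  by apply: (@sub_countable _ _ _ L) => //; apply: subset_card_le; exact: subIsetr.
rewrite adde0 -countable_measure_esum// -[in LHS](setUIDK B L).
rewrite measureU//; [|exact: measurableI|exact: measurableD|].
- rewrite -[RHS]adde0; congr (_ + _)%E; apply: null; first exact: measurableD.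
  by move=> x [Bx Lx]; split => //; exact: B0.
by apply/seteqP; split => // x [[_ Lx] [_ nLx]].
Qed.

End PurePoint.

(** * Power-like entries *)

Section PowerEntries.
Variables (R : realType) (alpha b : R).
Hypotheses (alpha_gt0 : 0 < alpha) (alpha_lt1 : alpha < 1) (b_gt0 : 0 < b).
Local Notation a := (offdiag_entry alpha).
Local Notation d := (diag_entry alpha b).

Lemma offdiag_gt0 n : (0 < n)%N -> 0 < a n.
Proof. by move=> n0; rewrite powR_gt0// ltr0n. Qed.

Lemma offdiag_neq0 n : a n.+1 != 0.
Proof. by rewrite gt_eqF// offdiag_gt0. Qed.

Lemma offdiag_nd n : a n <= a n.+1.
Proof. by rewrite ge0_ler_powR ?nnegrE ?ler_nat// ltW. Qed.

Lemma offdiag_le n : a n <= n%:R.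
Proof.
case: n => [|n]; first by rewrite /offdiag_entry powR0// gt_eqF.
rewrite -[leRHS](powRr1 (ler0n R n.+1)) ler_powR ?ler1n//; exact: ltW.
Qed.

Lemma offdiag_unbounded A : exists k, A <= a k.
Proof.
have [A0|A0] := leP A 0; first by exists 0%N; apply: le_trans A0 (powR_ge0 _ _).
exists (Num.trunc (A `^ alpha^-1)).+1.
rewrite -{1}(powRr1 (ltW A0)) -(mulVf (lt0r_neq0 alpha_gt0)) powRrM.
by rewrite ge0_ler_powR ?nnegrE ?powR_ge0// ltW// truncnS_gt.
Qed.

(** Along the indices k j = 2^(j+1), linear growth makes (P (k j))^2 2^-(j+1)
    at least a fixed multiple of 2^j. *)
Lemma power_pure_point : pure_point_spectrum_on (jacobi_op a d) [set x : R | 0 < x].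
Proof.
move=> E ET.
have a_abs n : `|a n| <= n%:R by rewrite ger0_norm ?powR_ge0// offdiag_le.
apply: (pure_point_criterion ET offdiag_neq0 (k := fun j => (2 ^ j).*2)
  (countable_decaying d offdiag_neq0 a_abs)) => x x0 ndec.
have [[eps [M [e0 grow]]]|[C [M dec]]] := growth_or_decay (d := d)
  (p := fun n => opoly a d n x) b_gt0 x0 offdiag_gt0 offdiag_nd offdiag_le
  offdiag_unbounded (fun=> erefl) (fun n => opoly_rec d x (offdiag_neq0 n)) (oner_neq0 R).
- move=> /cvgr0Pnorm_lt /(_ (eps ^+ 2 / 2)) h.
  have e2 : 0 < eps ^+ 2 / 2 by rewrite divr_gt0// exprn_gt0.
  have [N _ {}h] := h e2.
  pose j := maxn N M.
  have Mj : (M <= 2 ^ j)%N.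
    by apply: leq_trans (leq_maxr N M) _; apply: ltnW; exact: ltn_expl.
  have := h j (leq_maxl N M); rewrite /= ltNge => /negP; apply.
  rewrite ger0_norm; last by apply: divr_ge0; [exact: sqr_ge0|].
  have gj := grow _ Mj.
  have p1 : 1 <= (2 ^ j)%:R :> R by rewrite ler1n expn_gt0.
  have p0 : 0 < (2 ^ j)%:R :> R by apply: lt_le_trans p1.
  rewrite addn1 expnS natrM ler_pdivlMr ?mulr_gt0//.
  have -> : eps ^+ 2 / 2 * (2 * (2 ^ j)%:R) = eps ^+ 2 * (2 ^ j)%:R by field.
  rewrite -(real_normK (num_real (opoly _ _ _ _))).
  apply: (@le_trans _ _ ((eps * (2 ^ j)%:R) ^+ 2)); last first.
    by rewrite ler_pXn2r ?nnegrE// mulr_ge0// ltW.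
  by rewrite exprMn ler_wpM2l ?sqr_ge0// expr2 ler_peMr// ltW.
- case: ndec; exists (`|C| + \sum_(0 <= k < M) k%:R * `|opoly a d k x|) => k.
  have s0 m : 0 <= \sum_(0 <= k < m) k%:R * `|opoly a d k x|.
    by apply: sumr_ge0 => i _; rewrite mulr_ge0.
  have [Mk|kM] := leqP M k.
    by apply: le_trans (dec _ Mk) _; apply: le_trans (ler_norm _) _; rewrite lerDl.
  rewrite (bigD1_seq k) ?mem_index_iota ?iota_uniq//=.
  rewrite addrCA lerDl addr_ge0// sumr_ge0// => i _; by rewrite mulr_ge0.
Qed.

(** The exponent is at least s sqrt m, as 1 - alpha/2 > 1/2; and
    exp q >= q^4 / 24. *)
Lemma decay_bound lambda : 0 < lambda -> exists2 K, 0 <= K &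
  forall m, (0 < m)%N -> m%:R * (m%:R * decay alpha b lambda m) <= K.
Proof.
move=> l0; rewrite /decay; set s := Num.sqrt _.
have al0 := alpha_gt0; have al1 := alpha_lt1.
have s0 : 0 < s by rewrite sqrtr_gt0 divr_gt0 ?mulr_gt0// powR_gt0.
exists (24 / s ^+ 4) => [|m m0]; first by rewrite divr_ge0// exprn_ge0// ltW.
have m1 : 1 <= m%:R :> R by rewrite ler1n.
have mp : 0 < m%:R :> R by rewrite ltr0n.
set t := _ `^ _ / _.
have qt : Num.sqrt m%:R <= t.
  rewrite -powR12_sqrt ?ler0n// ler_pdivlMr; last lra.
  apply: (@le_trans _ _ (m%:R `^ 2^-1)).
    by rewrite ler_piMr ?powR_ge0//; lra.
  by rewrite ler_powR//; lra.
have q0 : 0 < Num.sqrt m%:R :> R by rewrite sqrtr_gt0.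
have q2 : Num.sqrt m%:R ^+ 2 = m%:R :> R by rewrite sqr_sqrtr.
move: q0 q2 qt; set q := Num.sqrt _ => q0 q2 qt.
have e1 : (s * q) ^+ 4 / 24 <= expR (s * t).
  apply: (@le_trans _ _ (expR (s * q))); last by rewrite ler_expR ler_pM2l.
  apply: le_trans (expR_ge1Dxn 3 (ltW (mulr_gt0 s0 q0))).
  by rewrite (_ : 4`! = 24%N)// lerDr.
rewrite expRN mulrA ler_pdivrMr ?expR_gt0//.
have -> : m%:R * m%:R = 24 / s ^+ 4 * ((s * q) ^+ 4 / 24).
  by rewrite -q2; field; rewrite gt_eqF.
by rewrite ler_wpM2l// divr_ge0// exprn_ge0// ltW.
Qed.

End PowerEntries.

(** * The decaying solution at an eigenvalue *)

Section DecayingEigenvector.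
Variables (R : realType) (alpha b lambda : R).
Hypotheses (alpha_gt : 2 / 3 < alpha) (alpha_lt1 : alpha < 1) (b_gt0 : 0 < b).
Hypothesis lambda_gt0 : 0 < lambda.
Local Notation a := (offdiag_entry alpha).
Local Notation d := (diag_entry alpha b).
Local Notation T := (jacobi_op a d).
Local Notation normc := Normc.normc.

Lemma normc_ge0 (z : R[i]) : 0 <= normc z.
Proof. by case: z => x y; rewrite sqrtr_ge0. Qed.

Lemma normc_real (x : R) : normc x%:C = `|x|.
Proof. by rewrite /= expr0n addr0 sqrtr_sqr. Qed.

Lemma ratio_cvg1 (u : nat -> R[i]) (w : nat -> R) :
  (forall m, (0 < m)%N -> w m != 0) ->
  (u m / (w m)%:C : R[i]^o) @[m --> \oo] --> (1 : R[i]^o) ->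
  exists M, forall m, (M <= m)%N -> u m != 0 /\ normc (u m) <= 2 * `|w m|.
Proof.
move=> w0 /cvgrPdist_lt /(_ 1 ltr01)[M _ h].
exists (maxn M 1) => m; rewrite geq_max => /andP[Mm m0].
have := h m Mm; rewrite /=; set r := u m / _ => hr.
have wC : (w m)%:C != 0 :> R[i] by rewrite eq_complex /= eqxx andbT w0.
have uE : u m = r * (w m)%:C by rewrite /r divfK.
have r1 : normc (1 - r) < 1 by rewrite -ltcR.
split.
  apply/eqP => um; move: r1; rewrite /r um mul0r subr0.
  by rewrite /= expr0n addr0 sqrtr_sqr normr1 ltxx.
rewrite uE Normc.normcM normc_real ler_wpM2r//.
have -> : r = 1 - (1 - r) by ring.
apply: le_trans (le_normcD _ _) _; rewrite normcN.
by rewrite (_ : normc 1 = 1) ?Normc.normc1//; lra.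
Qed.

Lemma solution_eq0 (w : nat -> R[i]) :
  spectral_solution a d lambda w -> w 1%N = 0 -> w 2 = 0 -> forall n, w n = 0.
Proof.
move=> [w0 rec] w1 w2; case=> // n.
suff [] : w n.+1 = 0 /\ w n.+2 = 0 by [].
elim: n => [|n [h1 h2]]//; split=> //.
have := rec n.+2 isT; rewrite /= h1 h2 !mulr0 !add0r => /eqP.
rewrite mulf_eq0 => /orP[|/eqP//].
by rewrite eq_complex /= eqxx andbT (negbTE (offdiag_neq0 alpha n.+1)).
Qed.

Lemma wronskian_const (u v : nat -> R[i]) :
  spectral_solution a d lambda u -> spectral_solution a d lambda v ->
  forall n, (a n.+1)%:C * (u n.+1 * v n.+2 - u n.+2 * v n.+1) =
            (a 1%N)%:C * (u 1%N * v 2 - u 2 * v 1%N).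
Proof.
move=> [_ hu] [_ hv]; elim=> // n <-.
have eu := hu n.+2 isT; have ev := hv n.+2 isT; rewrite /= in eu ev.
transitivity ((a n.+1)%:C * (u n.+1 * v n.+2 - u n.+2 * v n.+1) +
  (u n.+2 * ((a n.+1)%:C * v n.+1 + (d n.+2)%:C * v n.+2 + (a n.+2)%:C * v n.+3) -
   ((a n.+1)%:C * u n.+1 + (d n.+2)%:C * u n.+2 + (a n.+2)%:C * u n.+3) * v n.+2)).
  by ring.
by rewrite eu ev; ring.
Qed.

(** The asymptotics give |u_(2m)| and |u_(2m+1)| at most a multiple of
    decay m, since the powers of m in them are at most 1, while a_n <= n. *)
Lemma uminus_bound (u : nat -> R[i]) : is_uminus alpha b lambda u ->
  exists K M, forall m, (M <= m)%N ->
    [/\ u m.*2 != 0, m%:R * (a m.*2 * normc (u m.*2)) <= K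
      & m%:R * (a m.*2.+1 * normc (u m.*2.+1)) <= K].
Proof.
move=> [_ he ho].
have al0 : 0 < alpha by apply: lt_trans alpha_gt; rewrite divr_gt0.
have [K K0 hK] := decay_bound al0 alpha_lt1 b_gt0 lambda_gt0.
have dec0 m : 0 < decay alpha b lambda m by exact: expR_gt0.
pose c := Num.sqrt (lambda / (2 `^ alpha * b)).
have c0 : 0 < c by rewrite sqrtr_gt0 divr_gt0// mulr_gt0// powR_gt0.
have sgn (m : nat) : `|(-1) ^+ m| = 1 :> R by rewrite normrX normrN1 expr1n.
have pw (beta : R) (m : nat) : (0 < m)%N -> 0 <= beta -> m%:R `^ (- beta) <= 1.
  move=> m0 be0; rewrite powRN invf_le1 ?powR_gt0 ?ltr0n//.
  have m1 : 1 <= m%:R :> R by rewrite ler1n.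
  by have := ler_powR m1 be0; rewrite powRr0.
have evenE m : `|uminus_even alpha b lambda m| =
    m%:R `^ (- (alpha / 4)) * decay alpha b lambda m.
  by rewrite /uminus_even !normrM sgn mul1r !ger0_norm ?powR_ge0// ltW.
have oddE m : `|uminus_odd alpha b lambda m| =
    c * (m%:R `^ (- (3 * alpha / 4)) * decay alpha b lambda m).
  rewrite /uminus_odd !normrM sgn mulr1 normrN -/c !ger0_norm ?powR_ge0 ?mulrA//; exact: ltW.
have even0 m : (0 < m)%N -> uminus_even alpha b lambda m != 0.
  by move=> m0; rewrite -normr_eq0 evenE lt0r_neq0// mulr_gt0// powR_gt0 ?ltr0n.
have odd0 m : (0 < m)%N -> uminus_odd alpha b lambda m != 0.
  by move=> m0; rewrite -normr_eq0 oddE lt0r_neq0// !mulr_gt0// powR_gt0 ?ltr0n.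
have [M1 h1] := ratio_cvg1 even0 he; have [M2 h2] := ratio_cvg1 odd0 ho.
exists (4 * K + 6 * c * K), (maxn 1 (maxn M1 M2)) => m.
rewrite !geq_max => /and3P[m0 M1m M2m].
have [u0 ue] := h1 _ M1m; have [_ uo] := h2 _ M2m.
have mp : 0 < m%:R :> R by rewrite ltr0n.
set D := decay alpha b lambda in dec0 hK evenE oddE *.
have mD := hK m m0; have Dm := dec0 m.
have ue' : normc (u m.*2) <= 2 * D m.
  apply: le_trans ue _; rewrite evenE ler_wpM2l// ler_piMl ?(ltW Dm)// pw//.
  by rewrite divr_ge0// ltW.
have uo' : normc (u m.*2.+1) <= 2 * c * D m.
  apply: le_trans uo _; rewrite oddE -[leRHS]mulrA; apply: ler_wpM2l => //.
  apply: ler_wpM2l; first exact: ltW.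
  by rewrite ler_piMl ?(ltW Dm)// pw// divr_ge0// mulr_ge0// ltW.
have ae : a m.*2 <= 2 * m%:R.
  by apply: le_trans (offdiag_le al0 alpha_lt1 _) _; rewrite -muln2 natrM mulrC.
have ao : a m.*2.+1 <= 3 * m%:R.
  apply: le_trans (offdiag_le al0 alpha_lt1 _) _; rewrite -natrM ler_nat.
  by rewrite -(addn1 m.*2) -addnn !mulSn mul0n addn0 addnA leq_add2l.
have cK : 0 <= c * K by rewrite mulr_ge0// ltW.
split => //.
  apply: (@le_trans _ _ (m%:R * (2 * m%:R * (2 * D m)))).
    by rewrite ler_wpM2l// ler_pM// ?powR_ge0 ?normc_ge0.
  lra.
apply: (@le_trans _ _ (m%:R * (3 * m%:R * (2 * c * D m)))).
  by rewrite ler_wpM2l// ler_pM// ?powR_ge0 ?normc_ge0.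
have := ler_wpM2l (ltW c0) mD; lra.
Qed.

(** The Wronskian of u and the given eigenvector v is constant and tends to 0, so
    u and v are proportional at the first two indices; v_1 is not 0, as the
    equation at the index 1 would otherwise make v vanish. *)
Lemma uminus_eigenvector (u : nat -> R[i]) :
  point_spectrum T lambda%:C -> is_uminus alpha b lambda u -> eigenvector T lambda%:C u.
Proof.
move=> [v [[n0 vn0] Tv]] uu.
have [su _ _] := uu; have [K [M bound]] := uminus_bound uu.
have [lv _ _] := Tv; have Jv := jacobi_opE Tv.
have Jvn n : lambda%:C * v n = jacobi_expr a d v n by rewrite -Jv.
have sv : spectral_solution a d lambda v.
  by split; [case: lv|case=> [|[|n]]// _; rewrite Jvn].
pose V := Num.sqrt (l2normsq v).
have V0 : 0 <= V by exact: sqrtr_ge0.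
have vV n : normc (v n) <= V by exact: normc_le_l2.
pose W := u 1%N * v 2 - u 2 * v 1%N.
have [a1 aW] : (a 1%N)%:C != 0 :> R[i] /\ (a 1%N)%:C * W = 0.
  split; first by rewrite eq_complex /= eqxx andbT offdiag_neq0.
  apply: Normc.eq0_normc; apply/eqP; rewrite eq_le normc_ge0 andbT leNgt.
  apply/negP => w0.
  set w := normc _ in w0.
  pose m := maxn M.+1 (Num.trunc (2 * K * V / w)).+1.
  have Mm : (M <= m)%N by apply: ltnW; exact: leq_maxl.
  have [_ be bo] := bound m Mm.
  have mlarge : 2 * K * V / w < m%:R.
    by apply: lt_le_trans (truncnS_gt _) _; rewrite ler_nat leq_maxr.
  have wE : w <= V * (a m.*2 * normc (u m.*2)) + V * (a m.*2.+1 * normc (u m.*2.+1)).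
    have m2 : m.*2 = m.*2.-1.+1 by rewrite prednK// double_gt0 leq_max.
    have e1 := wronskian_const su sv m.*2.-1; rewrite -m2 in e1.
    rewrite /w /W -e1 Normc.normcM normc_real ger0_norm ?powR_ge0//.
    apply: (@le_trans _ _ (a m.*2 * (normc (u m.*2) * V + normc (u m.*2.+1) * V))).
      rewrite ler_wpM2l ?powR_ge0//; apply: le_trans (le_normcD _ _) _.
      by rewrite normcN !Normc.normcM lerD// ler_wpM2l ?normc_ge0.
    rewrite mulrDr; apply: lerD; first by rewrite mulrA mulrC.
    rewrite mulrA (mulrC V) ler_wpM2r// ler_wpM2r ?normc_ge0//.
    by apply: offdiag_nd => //; apply: lt_trans alpha_gt; rewrite divr_gt0.
  move: mlarge; rewrite ltr_pdivrMr// ltNge => /negP; apply.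
  apply: le_trans (ler_wpM2l (ler0n R m) wE) _.
  have := ler_wpM2l V0 be; have := ler_wpM2l V0 bo; lra.
have {aW a1} W0 : u 1%N * v 2 = u 2 * v 1%N.
  move/eqP: aW; rewrite mulf_eq0 (negbTE a1) /= => /eqP; rewrite /W => /eqP.
  by rewrite subr_eq0 => /eqP.
have v1 : v 1%N != 0.
  apply/eqP => v1z; case/eqP: vn0.
  have v2z : v 2 = 0.
    have := Jvn 1%N; rewrite /= v1z !mulr0 add0r => /esym/eqP.
    by rewrite mulf_eq0 eq_complex /= eqxx andbT (negbTE (offdiag_neq0 alpha 0)) => /eqP.
  exact: (solution_eq0 sv v1z v2z).
pose t := u 1%N / v 1%N.
have uE : u = fun n => t * v n.
  apply/funext => n; apply/eqP; rewrite -subr_eq0; apply/eqP.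
  apply: (@solution_eq0 (fun n => u n - t * v n)).
  - split; first by case: su => ->; case: sv => ->; rewrite mulr0 subr0.
    move=> k k2; have [_ /(_ k k2) hu] := su; have [_ /(_ k k2) hv] := sv.
    by rewrite [RHS]mulrBr -hu (mulrCA lambda%:C) -hv; ring.
  - by rewrite /t divfK// subrr.
  - by rewrite /t mulrAC W0 mulfK// subrr.
split; first by exists M.*2; have [] := bound M (leqnn _).
have := jacobi_op_scale t Tv; rewrite -uE.
have -> // : (fun n => t * (lambda%:C * v n)) = (fun n => lambda%:C * u n).
by apply/funext => n; rewrite uE mulrCA.
Qed.

End DecayingEigenvector.

Theorem mainTheorem2 (R : realType) (alpha b : R)
    (alpha_gt : 2 / 3 < alpha) (alpha_lt : alpha < 1) (b_gt0 : 0 < b) :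
  pure_point_spectrum_on (jacobi_op (offdiag_entry alpha) (diag_entry alpha b))
    [set x : R | 0 < x] /\
  (forall lambda : R, 0 < lambda ->
     point_spectrum (jacobi_op (offdiag_entry alpha) (diag_entry alpha b)) lambda%:C ->
     forall u : nat -> R[i], is_uminus alpha b lambda u ->
       eigenvector (jacobi_op (offdiag_entry alpha) (diag_entry alpha b)) lambda%:C u).
Proof.
have alpha_gt0 : 0 < alpha by apply: lt_trans alpha_gt; rewrite divr_gt0.
split; first exact: power_pure_point.
by move=> lambda l0 pl u uu; exact: uminus_eigenvector.
Qed.
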